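(* Let $N\ge2$ be an integer. The union of all admissible intervals covers (Lebesgue) almost every point of $(\beta_c(N),N)$, where $\beta_c(N)$ is the Komornik-Loreti constant. Moreover, for any two admissible intervals $[\alpha_L,\alpha_U]$ and $[\beta_L,\beta_U]$, either $[\alpha_L,\alpha_U]\cap[\beta_L,\beta_U]=\emptyset$ or $\alpha_U=\beta_U$.
   Context: Fix an integer $N\ge 2$. Blocks of equal length and infinite sequences over $\{0,1,\dots,N-1\}$ are compared lexicographically. For a digit $c$, $\overline{c}:=N-1-c$, and $\overline{c_1c_2\cdots}:=\overline{c_1}\,\overline{c_2}\cdots$ for blocks and sequences. For a block with $c_p<N-1$, $c_1\cdots c_p^+:=c_1\cdots c_{p-1}(c_p+1)$. $(c_1\cdots c_p)^\infty$ is the periodic sequence repeating the block. Quasi-greedy expansion: for $\beta\in(1,N]$, $(\alpha_i(\beta))_{i\ge1}$ is the quasi-greedy $\beta$-expansion of $1$: $\alpha_n(\beta)$ is recursively the largest element of $\{0,\dots,N-1\}$ with $\sum_{i=1}^{n}\alpha_i(\beta)\beta^{-i}<1$. (A base $\beta\in(1,N]$ is determined by its sequence $(\alpha_i(\beta))$.) Admissible block: $t_1\cdots t_p\in\{0,\dots,N-1\}^p$ is admissible if $t_p<N-1$ and for every $1\le i\le p$: $\overline{t_1\cdots t_p}\le t_i\cdots t_pt_1\cdots t_{i-1}$ and $t_i\cdots t_p^+\,\overline{t_1\cdots t_{i-1}}\le t_1\cdots t_p^+$. Generalized Thue-Morse sequence: $(\theta_i)=(\theta_i(t_1\cdots t_p^+))$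 is defined by $\theta_1\cdots\theta_p=t_1\cdots t_p^+$ and, for $m\ge0$, $\theta_{2^mp+1}\cdots\theta_{2^{m+1}p}=\overline{\theta_1\cdots\theta_{2^mp}}\,^+$. Admissible interval: the closed interval $[\beta_L,\beta_U]$ is the admissible interval generated by an admissible block $t_1\cdots t_p$ if $\beta_L,\beta_U\in(1,N]$ satisfy $(\alpha_i(\beta_L))=(t_1\cdots t_p)^\infty$ and $(\alpha_i(\beta_U))=(\theta_i(t_1\cdots t_p^+))$. An admissible interval is one generated by some admissible block. Komornik-Loreti constant: $\beta_c(N)$ is the unique positive solution of $1=\sum_{i=1}^\infty\lambda_i\beta^{-i}$, where $\lambda_i=k-1+\tau_i$ if $N=2k$ and $\lambda_i=k+\tau_i-\tau_{i-1}$ if $N=2k+1$, with $(\tau_i)_{i\ge0}$ the classical Thue-Morse sequence $0110\,1001\cdots$ ($\tau_i$ is the parity of the number of ones in the binary expansion of $i$). *)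

(* Defs.v *)
From mathcomp Require Import all_boot all_order all_algebra.
From mathcomp Require Import all_classical all_reals all_analysis.
Import Order.TTheory GRing.Theory Num.Theory.
Import numFieldNormedType.Exports.

Set Implicit Arguments.
Unset Strict Implicit.
Unset Printing Implicit Defensive.

Local Open Scope classical_set_scope.
Local Open Scope ring_scope.

(* The alphabet is {0, ..., N-1}, a block is a [seq nat], and a sequence
   (c_i)_{i >= 1} is the function [c : nat -> nat] whose value at [i] is the
   term c_{i+1}: all indices are shifted by one. *)

Definition reflect_block (N : nat) (s : seq nat) : seq nat :=
  [seq (N.-1 - c)%N | c <- s].

(* c_1 ... c_p^+ ; meaningful for nonempty blocks *)
Definition incr_last (s : seq nat) : seq nat := incr_nth s (size s).-1.

Definition lex_le (s t : seqlexi nat) : bool := (s <= t)%O.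

(* With i = i0 + 1: [rot i0 t] is t_i ... t_p t_1 ... t_{i-1},
   [drop i0 t] is t_i ... t_p and [take i0 t] is t_1 ... t_{i-1}. *)
Definition admissible_block (N : nat) (t : seq nat) : Prop :=
  [/\ (0 < size t)%N,
      all (fun c => c < N)%N t,
      (last 0 t < N.-1)%N &
      forall i0 : nat, (i0 < size t)%N ->
        lex_le (reflect_block N t) (rot i0 t) /\
        lex_le (incr_last (drop i0 t) ++ reflect_block N (take i0 t))
               (incr_last t)].

Definition periodic_seq (t : seq nat) (i : nat) : nat :=
  nth 0%N t (i %% size t).

(* theta_1 ... theta_{2^m p} *)
Fixpoint theta_block (N : nat) (t : seq nat) (m : nat) : seq nat :=
  if m is m'.+1 then
    theta_block N t m' ++ incr_last (reflect_block N (theta_block N t m'))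
  else incr_last t.

(* The blocks extend one another and, for nonempty t, [theta_block N t i] has
   length 2^i p > i, hence reaches the (i+1)-st term. *)
Definition theta (N : nat) (t : seq nat) (i : nat) : nat :=
  nth 0%N (theta_block N t i) i.

(* alpha_1(beta) ... alpha_n(beta); the recursion never maximizes over an empty
   set when 0 < beta, since the digit 0 is always allowed. *)
Fixpoint quasi_greedy_block (R : realType) (N : nat) (beta : R) (n : nat)
    : seq nat :=
  if n is n'.+1 then
    let s := quasi_greedy_block N beta n' in
    rcons s (\max_(d < N | (\sum_(i < n') (nth 0%N s i)%:R / beta ^+ i.+1
                            + (d : nat)%:R / beta ^+ n'.+1 < 1)%R) d)%N
  else [::].

Definition quasi_greedy (R : realType) (N : nat) (beta : R) (i : nat) : nat :=
  nth 0%N (quasi_greedy_block N beta i.+1) i.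

Definition generated_interval (R : realType) (N : nat) (t : seq nat)
    (betaL betaU : R) : Prop :=
  [/\ 1 < betaL <= N%:R,
      1 < betaU <= N%:R,
      quasi_greedy N betaL =1 periodic_seq t &
      quasi_greedy N betaU =1 theta N t].

(* The pair [I] stands for the interval [I.1, I.2]. *)
Definition admissible_interval (R : realType) (N : nat) (I : R * R) : Prop :=
  exists t : seq nat, admissible_block N t /\ generated_interval N t I.1 I.2.

(* [odd (i %/ 2 ^ j)] is the j-th binary digit of i, zero for j >= i. *)
Definition thue_morse (i : nat) : nat :=
  odd (\sum_(j < i) odd (i %/ 2 ^ j))%N.

(* lambda_i for i >= 1, without index shift. For N >= 2 the truncated
   subtractions are exact: k >= 1. *)
Definition kl_digit (N i : nat) : nat :=
  if odd N then (N./2 + thue_morse i - thue_morse i.-1)%N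
  else (N./2 - 1 + thue_morse i)%N.

Definition is_komornik_loreti (R : realType) (N : nat) (beta : R) : Prop :=
  0 < beta /\
  series (fun i : nat => (kl_digit N i.+1)%:R / beta ^+ i.+1 : R) @ \oo --> (1 : R).

(* For N >= 2 the set has exactly one element, so the default 0 is not used. *)
Definition komornik_loreti (R : realType) (N : nat) : R :=
  xget 0 [set beta : R | is_komornik_loreti N beta].

(* Main.v *)
Require Import Defs.
From mathcomp Require Import all_boot all_order all_algebra.
From mathcomp Require Import all_classical all_reals all_analysis.
From mathcomp Require Import zify ring lra.
Import Order.TTheory GRing.Theory Num.Theory.
Import numFieldNormedType.Exports.

(** Why the theorem holds.

Write a(x) for the quasi-greedy expansion of 1 in base x, s for the shift and
m for the digitwise reflection. For a sequence c, the numbers P_0(x) = 1,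
P_(n+1)(x) = x P_n(x) - c_n ([remainder]) satisfy 0 < P_n <= 1 for all n
exactly when c = a(x) (one direction is [quasi_greedy_bound], the other
[quasi_greedy_eq]). From this come the three standard facts: x |-> a(x) is
strictly increasing for the lexicographic order, no shift of a(x) exceeds
a(x), and every sequence with that last property and infinitely many nonzero
digits is some a(b) ([expansion_exists]).

Covering. Let V be the set of bases for which every shift of a(x) is at least
m(a(x)). If x is above the Komornik-Loreti constant but outside V, take the
least n such that the n-th shift of a(x) is below m(a(x)). Minimality makes
the first n digits of a(x), with the last one lowered, an admissible block t,
and t^infinity < a(x) < theta(t); the bounds on the first two digits that come
from x > beta_c dispose of short blocks ([admissible_cover]). Both endpoints
exist by [expansion_exists], hence x lies in an admissible interval.

V is null because it is porous. At x in V the remainder P_n is a convex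
increasing function of the base on the interval between its root a and x, it
does not exceed 1 there, and x - a tends to 0 as n grows. On the fixed
proportion of that interval where P_n is smaller than N^-(k+1), the expansion
keeps its first n digits and continues with k+1 zeros, which is too small for
membership in V once k is the position of a digit of a(x) smaller than N-1.
So V has no density point ([lower_bounded_hole], [porous_negligible]).

Intersections. An admissible block is better described by its raised version u:
every proper suffix of u lies strictly above the reflected prefix and weakly
below the prefix of the same length ([generator]). This is stable under the
doubling u |-> u m(u)^+ which produces theta. If c is t^infinity for an
admissible t and s^infinity <= c <= theta(s), then c is s^infinity, or c starts
with s^+ and lies between the doubled block and theta(s)
([doubling_step]). Iterating, c is the periodic sequence of some doubling of s,
as theta(s) itself is not periodic; so t is that doubling and
theta(t) = theta(s) ([theta_eq_between]). If two admissible intervals meet,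
one of them contains the left endpoint of the other, and the equality of the
sequences theta gives that of the right endpoints. *)

Set Implicit Arguments.
Unset Strict Implicit.
Unset Printing Implicit Defensive.

Local Open Scope classical_set_scope.
Local Open Scope nat_scope.

(** * Lexicographic order and the suffix form of admissibility *)

Definition tail (n : nat) (f : nat -> nat) (k : nat) : nat := f (n + k).
Definition mirror (N : nat) (f : nat -> nat) (k : nat) : nat := N.-1 - f k.

Definition first_lt (f g : nat -> nat) (j : nat) : Prop :=
  (forall i, i < j -> f i = g i) /\ f j < g j.
Definition lexlt (n : nat) (f g : nat -> nat) : Prop :=
  exists2 j, j < n & first_lt f g j.
Definition seqlt (f g : nat -> nat) : Prop := exists j, first_lt f g j.

Lemma lex_diffP (n : nat) (f g : nat -> nat) :
  (forall i, i < n -> f i = g i) \/ lexlt n f g \/ lexlt n g f.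
Proof.
elim: n => [|n [IH|[[j ltj H]|[j ltj H]]]]; first by left.
- have [lt|gt|eq] := ltngtP (f n) (g n).
  + by right; left; exists n.
  + by right; right; exists n => //; split=> // i /IH.
  + left=> i; rewrite ltnS leq_eqVlt => /orP[/eqP->|/IH] //.
- by right; left; exists j => //; apply: ltnW.
- by right; right; exists j => //; apply: ltnW.
Qed.

Lemma seq_diffP (f g : nat -> nat) : f =1 g \/ seqlt f g \/ seqlt g f.
Proof.
have [|nlt] := pselect (seqlt f g); first by right; left.
have [|ngt] := pselect (seqlt g f); first by right; right.
left=> k; have [H|[[j _ H]|[j _ H]]] := lex_diffP k.+1 f g.
- exact: H.
- by case: nlt; exists j.
- by case: ngt; exists j.
Qed.

Lemma first_lt_uniq (f g : nat -> nat) (i j : nat) :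
  first_lt f g i -> first_lt g f j -> False.
Proof.
move=> [eqi lti] [eqj ltj]; have [ij|ji|ij] := ltngtP i j.
- by move: lti; rewrite eqj // ltnn.
- by move: ltj; rewrite eqi // ltnn.
- by rewrite ij in lti; lia.
Qed.

Lemma seqlt_asym (f g : nat -> nat) : seqlt f g -> seqlt g f -> False.
Proof. by move=> [i fg] [j gf]; apply: first_lt_uniq fg gf. Qed.

Lemma seqlt_eq (f f' g g' : nat -> nat) : f =1 f' -> g =1 g' ->
  seqlt f g -> seqlt f' g'.
Proof. by move=> /funext<- /funext<-. Qed.

(** The bridge between the order on blocks of equal length and comparisons of
digit functions; all later arguments use the latter. *)
Lemma lex_leP (s t : seq nat) : size s = size t ->
  lex_le s t <-> ~ lexlt (size s) (nth 0 t) (nth 0 s).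
Proof.
rewrite /lex_le; elim: s t => [|x s IH] [|y t] //=.
  by move=> _; split=> // _ [].
move=> [] /IH{}IH; rewrite lexi_cons !leEnat.
have [xy|yx|->] := ltngtP x y => /=.
- by split=> // _ [[|j] _ [/= H /= lt]]; [lia | have /= := H 0 isT; lia].
- by split=> // H; case: H; exists 0 => //; split.
- rewrite IH; split=> H [j ltj [eqj lj]]; apply: H.
    case: j ltj eqj lj => [|j] /= ltj eqj lj; first by rewrite ltnn in lj.
    by exists j => //; split=> // i lti; apply: (eqj i.+1).
  exists j.+1 => //; split=> // -[|i] //=.
  exact: eqj.
Qed.

(** [u] restricted to [0, p) plays the role of t^+ for an admissible block t of
length p. The conditions of admissibility compare full rotations; here only
suffixes are compared with prefixes, strictly on the reflected side, which is
what survives doubling. [generator_head] encodes the rotation by 0, and for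
[p = 1] it has to account for the raised digit being the first one. *)
Record generator (N : nat) (u : nat -> nat) (p : nat) : Prop := Generator {
  generator_gt0 : 0 < p;
  generator_digit k : k < p -> u k < N;
  generator_last : 0 < u p.-1;
  generator_head : N + (p == 1) <= 2 * u 0;
  generator_lower i : 0 < i < p -> lexlt (p - i) (mirror N u) (tail i u);
  generator_upper i : 0 < i < p -> ~ lexlt (p - i) u (tail i u) }.

Definition decr_last (u : nat -> nat) (p k : nat) : nat := u k - (k == p.-1).
(** t^infinity, in terms of t^+. *)
Definition per (u : nat -> nat) (p k : nat) : nat := decr_last u p (k %% p).

Lemma per_lt (u : nat -> nat) (p k : nat) : k < p.-1 -> per u p k = u k.
Proof.
move=> kp; rewrite /per /decr_last modn_small; last by lia.
by rewrite ltn_eqF // subn0.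
Qed.

Lemma per_add (u : nat -> nat) (p k : nat) : per u p (p + k) = per u p k.
Proof. by rewrite /per modnDl. Qed.

Section Per.
Variables (N : nat) (u : nat -> nat) (p : nat).
Hypothesis gen : generator N u p.
Let p0 := generator_gt0 gen.

Lemma per_last : (per u p p.-1).+1 = u p.-1.
Proof.
have := generator_last gen.
by rewrite /per /decr_last modn_small ?eqxx; lia.
Qed.

Lemma per_digit k : per u p k < N.
Proof.
rewrite /per /decr_last.
by have := generator_digit gen (ltn_pmod k p0); lia.
Qed.

Lemma per_le k : k < p -> per u p k <= u k.
Proof. by move=> kp; rewrite /per /decr_last modn_small //; lia. Qed.

Lemma tail_per n : tail n (per u p) =1 tail (n %% p) (per u p).
Proof. by move=> k; rewrite /tail /per modnDml. Qed.

(** Lowering the last digit turns the weak upper bound on suffixes into a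
strict one; this is what makes the block of [per u p] primitive. *)
Lemma tail_per_lt i : 0 < i < p -> seqlt (tail i (per u p)) (per u p).
Proof.
move=> /andP[i0 ip]; have up : ~ lexlt (p - i) u (tail i u).
  by apply: (generator_upper gen); rewrite i0.
have [eq|[/up //|[j ltj [eqj lj]]]] := lex_diffP (p - i) u (tail i u).
  exists (p - i).-1; split=> [k kp|].
    rewrite /tail !per_lt; try lia.
    by rewrite [RHS]eq //; lia.
  rewrite /tail (_ : i + _ = p.-1); last by lia.
  rewrite (@per_lt _ _ ((p - i).-1)); last by lia.
  rewrite eq; last by lia.
  by rewrite /tail (_ : i + _ = p.-1); have := per_last; lia.
exists j; split=> [k kj|].
  rewrite /tail !per_lt; try lia.
  exact: eqj.
rewrite /tail (@per_lt _ _ j); last by lia.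
by apply: leq_ltn_trans lj; apply: per_le; lia.
Qed.

Lemma tail_per_le n : ~ seqlt (per u p) (tail n (per u p)).
Proof.
move=> /(seqlt_eq (frefl _) (tail_per n)).
have [-> [j [_]]|i0] := posnP (n %% p); first by rewrite ltnn.
apply: seqlt_asym; apply: tail_per_lt.
by rewrite i0 ltn_pmod.
Qed.

Lemma per_head : mirror N (per u p) 0 <= per u p 0.
Proof.
move: (generator_head gen); rewrite /mirror; have [-> H|p1] := eqVneq p 1.
  by move: H; rewrite /per /decr_last modn1 /=; lia.
by have := p0; rewrite per_lt; lia.
Qed.

(** The comparison of a suffix with the reflected prefix may end in a tie after
the last digit is lowered. The rest of the comparison is then, up to
reflection, the same question for the complementary shift at an earlier
position, whence the induction on the first difference. *)
Lemma tail_per_ge n : ~ seqlt (tail n (per u p)) (mirror N (per u p)).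
Proof.
move=> /(seqlt_eq (tail_per n) (frefl _)).
move: (n %% p) (ltn_pmod n p0) => i ip [j].
elim/ltn_ind: j i ip => j IH i ip; have [->|i0] := posnP i.
  have h0 := per_head.
  case: j {IH} => [|j] [eqj lj].
    by move: lj h0; rewrite /tail addn0; lia.
  have := eqj 0 isT; rewrite /tail add0n => e0.
  have p1 : p = 1.
    have := generator_head gen; move: e0; rewrite /mirror.
    have [//|p1] := eqVneq p 1.
    by have := generator_digit gen p0; rewrite per_lt; lia.
  have cst k : per u p k = per u p 0 by rewrite /per p1 !modn1.
  by move: lj e0; rewrite /tail /mirror !cst; lia.
move=> [eqj lj]; have [jp|jp] := ltnP j (p - i).
  have [|j0 j0p [eq0 l0]] := @generator_lower _ _ _ gen i; first by rewrite i0.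
  have [jj|jj|jj] := ltngtP j j0.
  - move: lj; rewrite /tail /mirror !per_lt; try lia.
    by have := eq0 _ jj; rewrite /tail /mirror; lia.
  - have := eqj _ jj; rewrite /tail /mirror !per_lt; try lia.
    by move: l0; rewrite /tail /mirror; lia.
  - move: lj l0; rewrite jj /tail /mirror (@per_lt _ _ j0); last by lia.
    have [ee|ne] := eqVneq (i + j0) p.-1; first by rewrite ee; have := per_last; lia.
    by rewrite per_lt; lia.
have lt1 : j - (p - i) < j by lia.
have lt2 : p - i < p by lia.
apply: (IH _ lt1 _ lt2); split=> [k kj|].
  have := eqj (p - i + k).
  rewrite /tail /mirror (_ : i + (p - i + k) = p + k); last by lia.
  rewrite per_add; move=> -> //; last by lia.
  by have := per_digit (p - i + k); lia.
move: lj; rewrite /tail /mirror (_ : i + j = p + (j - (p - i))); last by lia.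
rewrite per_add (_ : p - i + (j - (p - i)) = j); last by lia.
by have := per_digit j; lia.
Qed.

End Per.

(** * Doubling and the generalized Thue-Morse sequence *)

(** With w = u m(u)^+, suffixes of w starting in the first half are already
decided inside u in the lower comparison; in the upper one a tie inside u is
broken just after it, because there w continues with m(u) whereas the prefix
continues with a suffix of u, strictly above m(u). Suffixes starting in the
second half are reflections of suffixes of u. *)
Lemma generator_double (N : nat) (u : nat -> nat) (p : nat) :
  generator N u p ->
  (forall k, k < p -> u (p + k) = mirror N u k + (k == p.-1)) ->
  generator N u (p + p).
Proof.
move=> [p0 dig last0 head0 low up] dbl.
have dbl1 k : k < p.-1 -> u (p + k) = mirror N u k.
  by move=> kp; rewrite dbl; lia.
have dbl_last : u (p + p.-1) = (mirror N u p.-1).+1.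
  by rewrite dbl ?eqxx; lia.
split; first by lia.
- move=> k kp; have [/dig//|pk] := ltnP k p.
  rewrite (_ : k = p + (k - p)); last by lia.
  have := dig (k - p); have [->|ne] := eqVneq (k - p) p.-1.
    by rewrite dbl_last /mirror; lia.
  by rewrite dbl1 /mirror; lia.
- by rewrite (_ : (p + p).-1 = p + p.-1); [rewrite dbl_last | lia].
- by lia.
- move=> i /andP[i0 i2p]; have [ip|pi|->] := ltngtP i p.
  + have [|j jp H] := low i; first by rewrite i0.
    by exists j => //; lia.
  + pose j := i - p; have jp : 0 < j < p by rewrite /j; lia.
    have -> : i = p + j by rewrite /j; lia.
    have [eq|[/(up _ jp)//|[k0 k0p [eq lt]]]] := lex_diffP (p - j) u (tail j u).
      exists (p - j).-1; first by lia.
      split=> [k kp|].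
        by rewrite /tail -addnA dbl1 /mirror ?(eq k) //; lia.
      rewrite /tail -addnA (_ : j + _ = p.-1); last by lia.
      rewrite dbl_last /mirror eq; last by lia.
      by rewrite /tail (_ : j + _ = p.-1); lia.
    exists k0; first by lia.
    split=> [k kp|].
      rewrite /tail -addnA dbl1; last by lia.
      by rewrite /mirror -(eq k).
    rewrite /tail -addnA dbl; last by lia.
    by rewrite /mirror; move: lt; have := dig k0; rewrite /tail; lia.
  + exists p.-1; first by lia.
    split=> [k kp|]; first by rewrite /tail dbl1.
    by rewrite /tail dbl_last.
- move=> i /andP[i0 i2p] [j0 j0p H].
  have [ip|pi|ip] := ltngtP i p.
  + have j0p' : p - i <= j0.
      rewrite leqNgt; apply/negP => lt; apply: (up i); first by rewrite i0.
      by exists j0.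
    have [|j1 j1p [eq lt]] := low (p - i); first by lia.
    apply: (first_lt_uniq H (j := p - i + j1)); split=> [k kp|].
      have [kpi|kpi] := ltnP k (p - i); first by rewrite H.1 //; lia.
      rewrite /tail (_ : i + k = p + (k - (p - i))); last by lia.
      rewrite dbl1; last by lia.
      by rewrite eq ?/tail; [congr u|]; lia.
    rewrite /tail (_ : i + _ = p + j1); last by lia.
    by rewrite dbl1 //; lia.
  + pose j := i - p; have jp : 0 < j < p by rewrite /j; lia.
    have Ei : i = p + j by rewrite /j; lia.
    have [j1 j1p [eq lt]] := low j jp.
    move: H; rewrite Ei => -[eq' lt'].
    have [jj|jj|jj] := ltngtP j0 j1.
    * have := eq _ jj; move: lt'; rewrite /tail -addnA dbl1 /mirror; last by lia.
      by have := dig j0; lia.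
    * have := eq' _ jj; move: lt; rewrite /tail -addnA dbl1 /mirror; last by lia.
      by have := dig (j + j1); have := dig j1; lia.
    * move: lt lt'; rewrite jj /tail -addnA dbl /mirror; last by lia.
      by have := dig (j + j1); have := dig j1; lia.
  + apply: (first_lt_uniq H (j := 0)); split=> //.
    rewrite /tail ip dbl // /mirror.
    have [p1|p1] := eqVneq p 1.
      by have := dig 0 p0; move: head0; rewrite p1 /=; lia.
    by have := dig 0 p0; lia.
Qed.

(** The self-similarity of the generalized Thue-Morse sequence. *)
Definition doubling (N : nat) (u : nat -> nat) (p : nat) : Prop :=
  forall m k, k < 2 ^ m * p ->
    u (2 ^ m * p + k) = mirror N u k + (k == (2 ^ m * p).-1).

Lemma generator_pow (N : nat) (u : nat -> nat) (p : nat) :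
  generator N u p -> doubling N u p ->
  forall m, generator N u (2 ^ m * p).
Proof.
move=> gen dbl; elim=> [|m IH]; first by rewrite mul1n.
rewrite expnS mul2n -addnn mulnDl.
by apply: generator_double (dbl m).
Qed.

Lemma doubling_pow (N : nat) (u : nat -> nat) (p k : nat) :
  doubling N u p -> doubling N u (2 ^ k * p).
Proof. by move=> dbl m j; rewrite mulnA -expnD; apply: dbl. Qed.

Lemma doubling_uniq (N : nat) (u v : nat -> nat) (p : nat) : 0 < p ->
  doubling N u p -> doubling N v p -> (forall k, k < p -> u k = v k) -> u =1 v.
Proof.
move=> p0 du dv uv.
have uvm m k : k < 2 ^ m * p -> u k = v k.
  elim: m k => [|m IH] k; first by rewrite mul1n; apply: uv.
  rewrite expnS mul2n -addnn mulnDl => kp.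
  have [/IH//|pk] := ltnP k (2 ^ m * p).
  rewrite -(subnKC pk) du; last by lia.
  by rewrite dv ?/mirror ?IH //; lia.
move=> k; apply: (uvm k); apply: leq_trans (ltn_expl k (isT : 1 < 2)) _.
by rewrite leq_pmulr.
Qed.

Section Theta.
Variables (N : nat) (t : seq nat).
Hypothesis t0 : 0 < size t.

Lemma size_incr_last (s : seq nat) : 0 < size s -> size (incr_last s) = size s.
Proof. by rewrite /incr_last size_incr_nth => s0; rewrite prednK // leqnn. Qed.

Lemma nth_incr_last (s : seq nat) k :
  nth 0 (incr_last s) k = nth 0 s k + (k == (size s).-1).
Proof. by rewrite /incr_last nth_incr_nth addnC eq_sym. Qed.

Lemma size_theta_block m : size (theta_block N t m) = 2 ^ m * size t.
Proof.
elim: m => [|m IH] /=; first by rewrite size_incr_last ?mul1n.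
have p0 : 0 < 2 ^ m * size t by rewrite muln_gt0 expn_gt0.
rewrite size_cat size_incr_last size_map IH // expnS mul2n -addnn.
by rewrite mulnDl.
Qed.

Lemma theta_blockE m m' k : k < 2 ^ m * size t -> m <= m' ->
  nth 0 (theta_block N t m') k = nth 0 (theta_block N t m) k.
Proof.
move=> km /subnK<-; elim: (m' - m) => [//|d IH].
rewrite addSn /= nth_cat size_theta_block ifT //.
by apply: (leq_trans km); rewrite leq_mul2r leq_exp2l // leq_addl orbT.
Qed.

Lemma thetaE m k : k < 2 ^ m * size t ->
  theta N t k = nth 0 (theta_block N t m) k.
Proof.
move=> km; have kk : k < 2 ^ k * size t.
  by apply: leq_trans (ltn_expl k (isT : 1 < 2)) _; rewrite leq_pmulr.
rewrite /theta; have [mk|/ltnW km'] := leqP m k.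
  exact: theta_blockE.
by rewrite (theta_blockE kk km').
Qed.

Lemma theta_start k : k < size t -> theta N t k = nth 0 (incr_last t) k.
Proof. by move=> kt; rewrite (@thetaE 0) ?mul1n. Qed.

Lemma theta_doubling : doubling N (theta N t) (size t).
Proof.
move=> m k km; rewrite (@thetaE m.+1) /=; last first.
  by rewrite expnS mul2n -addnn mulnDl ltn_add2l.
rewrite nth_cat size_theta_block ltnNge leq_addr /= addKn.
rewrite nth_incr_last size_map size_theta_block; congr (_ + _).
by rewrite (nth_map 0) ?size_theta_block // /mirror (@thetaE m).
Qed.

End Theta.

Lemma generator_agree (N : nat) (u v : nat -> nat) (p : nat) :
  (forall k, k < p -> u k = v k) -> generator N u p -> generator N v p.
Proof.
move=> uv [p0 dig last0 head0 low up]; split=> //.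
- by move=> k kp; rewrite -uv //; apply: dig.
- by rewrite -uv //; lia.
- by rewrite -uv.
- move=> i ip; have [j jp [eq lt]] := low i ip; exists j => //; split=> [k kj|].
    by have := eq k kj; rewrite /mirror /tail !uv //; lia.
  by move: lt; rewrite /mirror /tail !uv //; lia.
- move=> i ip [j jp [eq lt]]; apply: (up i ip); exists j => //; split=> [k kj|].
    by have := eq k kj; rewrite /tail !uv //; lia.
  by move: lt; rewrite /tail !uv //; lia.
Qed.

Section Admissible.
Variables (N : nat) (t : seq nat).
Let u := nth 0 (incr_last t).
Let p := size t.

Lemma nth_decr_last k : 0 < p -> nth 0 t k = decr_last u p k.
Proof. by move=> p0; rewrite /decr_last /u nth_incr_last addnK. Qed.

Lemma per_periodic : 0 < p -> per u p =1 periodic_seq t.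
Proof. by move=> p0 k; rewrite /per /periodic_seq nth_decr_last. Qed.

Lemma block_rotE i : 0 < p -> i < p ->
  lex_le (reflect_block N t) (rot i t) <->
  ~ lexlt p (tail i (per u p)) (mirror N (per u p)).
Proof.
move=> p0 ip; rewrite lex_leP size_map ?size_rot //.
have E1 k : k < p -> nth 0 (rot i t) k = tail i (per u p) k.
  move=> kp; rewrite /tail /per /rot nth_cat size_drop -/p.
  case: ltnP => kpi.
    by rewrite nth_drop nth_decr_last // modn_small //; lia.
  rewrite nth_take; last by lia.
  rewrite nth_decr_last // (_ : i + k = k - (p - i) + p); last by lia.
  by rewrite modnDr modn_small //; lia.
have E2 k : k < p -> nth 0 (reflect_block N t) k = mirror N (per u p) k.
  by move=> kp; rewrite (nth_map 0) // nth_decr_last // /mirror /per modn_small.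
rewrite -/p; split=> H [j jp [eq lt]]; apply: H; exists j => //; split=> [k kj|].
- by rewrite E1 ?E2; [exact: eq | lia | lia].
- by rewrite E1 ?E2.
- by rewrite -E1 -?E2; [exact: eq | lia | lia].
- by rewrite -E1 -?E2.
Qed.

(** [take i t] never contains the last digit of t, hence coincides with the same
prefix of t^+. *)
Lemma block_dropE i : 0 < p -> i < p ->
  lex_le (incr_last (drop i t) ++ reflect_block N (take i t)) (incr_last t) <->
  ~ lexlt p u (fun k => if k < p - i then u (i + k) else mirror N u (k - (p - i))).
Proof.
move=> p0 ip.
have sd : size (incr_last (drop i t)) = p - i.
  by rewrite size_incr_last size_drop; lia.
have sb : size (incr_last (drop i t) ++ reflect_block N (take i t)) = p.
  rewrite size_cat sd size_map size_take -/p ip; lia.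
rewrite lex_leP; last by rewrite sb size_incr_last.
rewrite sb.
have E k : k < p -> nth 0 (incr_last (drop i t) ++ reflect_block N (take i t)) k
   = if k < p - i then u (i + k) else mirror N u (k - (p - i)).
  move=> kp; rewrite nth_cat sd; case: ltnP => kpi.
    rewrite /u !nth_incr_last nth_drop size_drop; congr (_ + _).
    by rewrite -/p; lia.
  rewrite (nth_map 0) ?nth_take ?size_take -/p ?ip; try lia.
  by rewrite /mirror /u nth_incr_last -/p; lia.
split=> H [j jp [eq lt]]; apply: H; exists j => //; split=> [k kj|].
- by rewrite E; [exact: eq | lia].
- by rewrite E.
- by rewrite -E; [exact: eq | lia].
- by rewrite -E.
Qed.

(** A tie between a suffix of t^+ and the reflected prefix would make the rotation
of t start below the reflection of t, since t lowers the last digit of that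
suffix: this gives strictness in [generator_lower]. The rotation by 0 shows that
the first digit is at least its reflection; for p > 1 equality would leave no
room for the last digit between the two suffix bounds, which gives
[generator_head]. *)
Lemma admissible_generator : admissible_block N t -> generator N u p.
Proof.
move=> [p0 /allP digt lastt adm].
have dig k : k < p -> nth 0 t k < N by move=> kp; apply: digt; rewrite mem_nth.
have lastE : nth 0 t p.-1 = last 0 t by rewrite nth_last.
have uE k : u k = nth 0 t k + (k == p.-1) by rewrite /u nth_incr_last.
have digu k : k < p -> u k < N.
  move=> kp; rewrite uE; have [->|_] := eqVneq k p.-1; last first.
    by rewrite addn0 dig.
  by rewrite lastE; lia.
have A i : i < p -> ~ lexlt p (tail i (per u p)) (mirror N (per u p)).
  by move=> ip; apply/block_rotE => //; have [] := adm i ip.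
have B i : i < p -> ~ lexlt p u (fun k => if k < p - i then u (i + k)
    else mirror N u (k - (p - i))).
  by move=> ip; apply/block_dropE => //; have [] := adm i ip.
have perE k : k < p.-1 -> per u p k = u k.
  move=> kp; rewrite /per /decr_last modn_small; last by lia.
  by rewrite ltn_eqF // subn0.
have ulast : u p.-1 = (per u p p.-1).+1.
  rewrite /per /decr_last modn_small ?eqxx; last by lia.
  by have := uE p.-1; rewrite eqxx; lia.
have up i : 0 < i < p -> ~ lexlt (p - i) u (tail i u).
  move=> /andP[i0 ip] [j jp [eq lt]]; apply: (B i ip); exists j; first by lia.
  split=> [k kj|]; first by rewrite ifT; [exact: eq | lia].
  by rewrite ifT.
have low i : 0 < i < p -> lexlt (p - i) (mirror N u) (tail i u).
  move=> /andP[i0 ip]; have [eq|[//|[j jp [eq lt]]]] :=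
    lex_diffP (p - i) (mirror N u) (tail i u); last first.
    case: (A i ip); exists j; first by lia.
    split=> [k kj|].
      rewrite /tail /mirror !perE; try lia.
      exact: eq.
    move: lt; rewrite /tail /mirror (perE j); last by lia.
    have [->|ne] := eqVneq (i + j) p.-1; first by rewrite ulast; lia.
    by rewrite perE; lia.
  case: (A i ip); exists (p - i).-1; first by lia.
  split=> [k kj|].
    rewrite /tail /mirror !perE; try lia.
    by rewrite -[RHS]/(mirror N u k) eq //; lia.
  have := eq (p - i).-1; rewrite /tail /mirror (perE (p - i).-1); last by lia.
  by rewrite (_ : i + _ = p.-1); [rewrite ulast|]; lia.
split=> //.
- by rewrite ulast.
- case: (posnP p.-1) => [p1|p1].
    have pp : p = 1 by lia.
    have : mirror N (per u p) 0 <= per u p 0.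
      rewrite leqNgt; apply/negP => lt; apply: (A 0 p0).
      by exists 0 => //; split.
    rewrite pp /= /mirror -{1 2}(_ : p.-1 = 0); last by lia.
    by move: ulast; rewrite pp /=; lia.
  have : mirror N u 0 <= u 0.
    rewrite leqNgt; apply/negP => lt; apply: (A 0 p0).
    exists 0 => //; split=> //.
    by rewrite /mirror /tail addn0 perE.
  rewrite /mirror => H; have -> : (p == 1) = false by lia.
  have [//|lt] := leqP (N + 0) (2 * u 0).
  have u1 : u 0 = N.-1 - u 0 by lia.
  have [|[|j] jp [eq lt']] := low p.-1; try lia.
  move: lt'; rewrite /mirror /tail addn0 => lt'.
  case: (up p.-1); first by lia.
  by exists 0; [lia|split=> //; rewrite /tail addn0; lia].
Qed.

(** When a suffix ties with the prefix in the second admissibility condition, the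
reflected part is compared with the complementary suffix, and
[generator_lower] decides. *)
Lemma generator_admissible : 0 < p -> generator N u p -> admissible_block N t.
Proof.
move=> p0 gen; have [_ dig last0 head0 low up] := gen.
have lastE : last 0 t = per u p p.-1.
  by rewrite -nth_last nth_decr_last // /per modn_small //; lia.
split=> //.
- apply/(all_nthP 0) => k kp; rewrite nth_decr_last //.
  by apply: leq_ltn_trans (dig _ kp); rewrite /decr_last; lia.
- have := per_last gen; have := dig p.-1; lia.
move=> i ip; split.
  apply/block_rotE => // -[j _ H]; apply: (tail_per_ge gen (n := i)).
  by exists j.
apply/block_dropE => // -[j jp [eq lt]].
have [i0|i0] := posnP i.
  by move: lt; rewrite i0 subn0 jp ltnn.
have ipp : 0 < i < p by rewrite i0.
have ipp' : 0 < p - i < p by lia.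
have [ji|ji] := ltnP j (p - i).
  apply: (up i ipp); exists j => //; split=> [k kj|].
    by rewrite eq // ifT //; lia.
  by move: lt; rewrite ji.
have [j1 j1p [eq1 lt1]] := low _ ipp'.
have H k : u (p - i + k) = tail (p - i) u k by [].
have [jj|jj|jj] := ltngtP (j - (p - i)) j1.
- have := eq1 _ jj; rewrite -H; move: lt; rewrite ifF; last by lia.
  by rewrite (subnKC ji) => ?; lia.
- have := eq (p - i + j1); rewrite ifF; last by lia.
  by rewrite addKn => /(_ _); rewrite H; lia.
- move: lt; rewrite ifF; last by lia.
  rewrite jj -{1}(subnKC ji) jj H; lia.
Qed.

End Admissible.

(** * Sequences between a periodic sequence and its Thue-Morse limit *)

Section Doubling.
Variables (N : nat) (c : nat -> nat).
Hypothesis c_upper : forall n, ~ seqlt c (tail n c).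
Hypothesis c_lower : forall n, ~ seqlt (tail n c) (mirror N c).

(** If c does not start with u, then squeezing forces it to start with u lowered,
and the upper bound on shifts propagates this forever. If it does, c is u
followed by a tail that is at least m(c), and comparing c with its own
reflection shows that it cannot drop below the periodic sequence of u m(u),
which is its own reflection after [p] digits. *)
Lemma doubling_step (u : nat -> nat) (p : nat) :
  generator N u p ->
  (forall k, k < p -> u (p + k) = mirror N u k + (k == p.-1)) ->
  ~ seqlt c (per u p) -> ~ seqlt u c ->
  c =1 per u p \/
  (forall k, k < p -> c k = u k) /\ ~ seqlt c (per u (p + p)).
Proof.
move=> gen dbl cper cu; have p0 := generator_gt0 gen.
have [eq|[[j jp [eq lt]]|[j _ H]]] := lex_diffP p c u; last first.
- by case: cu; exists j.
- left; have jE : j = p.-1.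
    have [//|ne] := eqVneq j p.-1; case: cper; exists j; split=> [k kj|].
      by rewrite per_lt ?eq //; lia.
    by rewrite per_lt //; lia.
  subst j; have agree k : k < p -> c k = per u p k.
    move=> kp; have [->|ne] := eqVneq k p.-1; last first.
      by rewrite per_lt ?eq //; lia.
    have := per_last gen; have [l|l|->] := ltngtP (c p.-1) (per u p p.-1) => //.
      move=> _; case: cper; exists p.-1; split=> // i ip.
      by rewrite per_lt ?eq.
    by lia.
  have [//|[//|[j [eqj ltj]]]] := seq_diffP c (per u p).
  have pj : p <= j.
    by rewrite leqNgt; apply/negP => /agree e; move: ltj; rewrite e ltnn.
  case: (c_upper (n := p)); exists (j - p); split=> [k kj|].
    by rewrite /tail -(eqj (p + k)) ?per_add ?eqj //; lia.
  rewrite /tail subnKC //; apply: leq_ltn_trans ltj.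
  rewrite -{2}(subnKC pj) per_add // eqj //; lia.
- right; split=> // -[j [eqj ltj]].
  have gen2 := generator_double gen dbl.
  (* w is the periodic sequence of u m(u): shifting it by p reflects it *)
  set w := per u (p + p) in eqj ltj.
  have w1 k : k < p -> w k = u k by move=> kp; rewrite /w per_lt //; lia.
  have w2 k : k < p -> w (p + k) = mirror N w k.
    move=> kp; rewrite /mirror (w1 k) //.
    have := dbl k kp; have [->|ne] := eqVneq k p.-1 => dk.
      have := per_last gen2; rewrite (_ : (p + p).-1 = p + p.-1); last by lia.
      by rewrite -/w dk /mirror /=; lia.
    by rewrite /w per_lt; rewrite ?dk /mirror; lia.
  have wm k : w (p + k) = mirror N w k.
    have w3 i : w i = w (i %% (p + p)) by rewrite /w /per modn_mod.
    have kpp : k %% (p + p) < p + p by rewrite ltn_mod; lia.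
    rewrite w3 -modnDmr -w3 /mirror [w k]w3.
    have [kp|kp] := ltnP (k %% (p + p)) p; first by rewrite w2.
    move: (k %% (p + p)) kpp kp => i kpp kp.
    rewrite (_ : p + i = p + p + (i - p)); last by lia.
    rewrite /w per_add -/w.
    rewrite (_ : w i = w (p + (i - p))); last by congr w; lia.
    rewrite w2 /mirror; last by lia.
    by have := per_digit gen2 (i - p); rewrite -/w; lia.
  have pj : p <= j.
    by rewrite leqNgt; apply/negP => jp; move: ltj; rewrite w1 // eq // ltnn.
  case: (c_lower (n := p)); exists (j - p); split=> [k kj|].
    rewrite /tail eqj; last by lia.
    by rewrite wm /mirror eqj //; lia.
  rewrite /tail /mirror subnKC //.
  rewrite -{2}(subnKC pj) wm /mirror -eqj in ltj; first by lia.
  by lia.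
Qed.

Lemma doubling_chain (u : nat -> nat) (p : nat) :
  generator N u p -> doubling N u p -> ~ seqlt c (per u p) -> ~ seqlt u c ->
  (exists m, c =1 per u (2 ^ m * p)) \/ c =1 u.
Proof.
move=> gen dbl cper cu.
have [|none] := pselect (exists m, c =1 per u (2 ^ m * p)); first by left.
have stp m : ~ seqlt c (per u (2 ^ m * p)).
  elim: m => [|m IH]; first by rewrite mul1n.
  have [e|[_]] := doubling_step (generator_pow gen dbl m) (dbl m) IH cu.
    by case: none; exists m.
  by rewrite expnS mul2n -addnn mulnDl.
right=> k.
have [e|[-> //]] := doubling_step (generator_pow gen dbl k) (dbl k) (stp k) cu.
  by case: none; exists k.
apply: leq_trans (ltn_expl k (isT : 1 < 2)) _.
by rewrite leq_pmulr // (generator_gt0 gen).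
Qed.

End Doubling.

(** On a block longer than the period, the shift by P = 2^q p is the reflection
except in its last digit; periodicity transports a correct digit onto that
exceptional one. *)
Lemma doubling_aperiodic (N : nat) (u : nat -> nat) (p q : nat) :
  0 < p -> doubling N u p -> 0 < q -> ~ (forall k, u (q + k) = u k).
Proof.
move=> p0 dbl q0 pr; set P := 2 ^ q * p.
have qP : q < P by apply: leq_trans (ltn_expl q (isT : 1 < 2)) _; rewrite leq_pmulr.
have e1 : u (P + P.-1) = (mirror N u P.-1).+1.
  by rewrite dbl ?eqxx ?addn1 // /P -/P; lia.
have e2 : u (P + (P.-1 - q)) = mirror N u (P.-1 - q).
  rewrite dbl -/P; last by lia.
  by rewrite (_ : (_ == _) = false) ?addn0 //; lia.
have e3 := pr (P + (P.-1 - q)).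
have e4 := pr (P.-1 - q).
move: e3; rewrite (_ : q + _ = P + P.-1); last by lia.
rewrite e1 e2 /mirror -e4 (_ : q + _ = P.-1); lia.
Qed.

(** A period shorter than [p] is a shift fixing the sequence, which
[tail_per_lt] excludes. *)
Lemma per_length_inj (N : nat) (u v : nat -> nat) (p q : nat) :
  generator N u p -> generator N v q -> per u p =1 per v q ->
  p = q /\ forall k, k < p -> u k = v k.
Proof.
have main (u' v' : nat -> nat) p' q' : generator N u' p' -> generator N v' q' ->
    per u' p' =1 per v' q' -> ~~ (q' < p').
  move=> gu gv e; apply/negP => qp; have q0 := generator_gt0 gv.
  have [|j [_]] := tail_per_lt gu (i := q'); first by rewrite q0.
  by rewrite /tail !e per_add // ltnn.
move=> gu gv e; have pq : p = q.
  have := main _ _ _ _ gu gv e.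
  have := main _ _ _ _ gv gu (fsym e).
  lia.
split=> // k kp; subst q; have := e k; have [->|ne] := eqVneq k p.-1.
  by have := per_last gu; have := per_last gv => <- <- ->.
by rewrite !per_lt //; lia.
Qed.

Lemma theta_generator (N : nat) (t : seq nat) : admissible_block N t ->
  generator N (theta N t) (size t).
Proof.
move=> adm; have [t0 _ _ _] := adm.
apply: generator_agree (admissible_generator adm) => k kt.
by rewrite theta_start.
Qed.

Lemma per_theta (N : nat) (t : seq nat) : 0 < size t ->
  per (theta N t) (size t) =1 periodic_seq t.
Proof.
move=> t0 k; rewrite -per_periodic // /per /decr_last.
by rewrite theta_start // ltn_mod.
Qed.

Lemma theta_eq_between (N : nat) (s t : seq nat) :
  admissible_block N s -> admissible_block N t ->
  ~ seqlt (periodic_seq t) (periodic_seq s) ->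
  ~ seqlt (theta N s) (periodic_seq t) ->
  theta N t =1 theta N s.
Proof.
move=> As At; have [s0 _ _ _] := As; have [t0 _ _ _] := At.
have gs := theta_generator As; have gt := theta_generator At.
have ds := theta_doubling N s0; have dt := theta_doubling N t0.
rewrite -(funext (per_theta N s0)) -(funext (per_theta N t0)) => lo hi.
have [[m e]|e] := doubling_chain (tail_per_le gt) (tail_per_ge gt)
  gs ds lo hi.
  have [tE agree] := per_length_inj gt (generator_pow gs ds m) e.
  apply: (doubling_uniq t0 dt _ agree).
  by rewrite tE; apply: doubling_pow.
case: (doubling_aperiodic s0 ds t0) => k.
by rewrite -!e per_add.
Qed.

Lemma theta_upper (N : nat) (u : nat -> nat) (p n : nat) :
  generator N u p -> doubling N u p -> ~ seqlt u (tail n u).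
Proof.
move=> gen dbl [j H]; have p0 := generator_gt0 gen.
have [n0|n0] := posnP n; first by case: H; rewrite n0 /tail add0n ltnn.
have lt : (n + j).+1 < 2 ^ (n + j).+1 * p.
  by apply: leq_trans (ltn_expl _ (isT : 1 < 2)) _; rewrite leq_pmulr.
apply: (generator_upper (generator_pow gen dbl (n + j).+1) (i := n)).
  by lia.
by exists j => //; lia.
Qed.

Lemma doubling_digit (N : nat) (u : nat -> nat) (p k : nat) :
  generator N u p -> doubling N u p -> u k < N.
Proof.
move=> gen dbl; have p0 := generator_gt0 gen.
apply: (generator_digit (generator_pow gen dbl k)).
by apply: leq_trans (ltn_expl _ (isT : 1 < 2)) _; rewrite leq_pmulr.
Qed.

Lemma doubling_infinite (N : nat) (u : nat -> nat) (p n : nat) :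
  generator N u p -> doubling N u p -> exists2 k, n <= k & 0 < u k.
Proof.
move=> gen dbl; have p0 := generator_gt0 gen.
exists (2 ^ n * p).-1; last exact: generator_last (generator_pow gen dbl n).
have : n < 2 ^ n * p.
  by apply: leq_trans (ltn_expl _ (isT : 1 < 2)) _; rewrite leq_pmulr.
lia.
Qed.

Lemma per_infinite (N : nat) (u : nat -> nat) (p n : nat) : 1 < N ->
  generator N u p -> exists2 k, n <= k & 0 < per u p k.
Proof.
move=> N1 gen; have p0 := generator_gt0 gen; exists (n * p).
  by rewrite leq_pmulr.
rewrite /per modnMl /decr_last; have := generator_head gen.
have [->|p1] := eqVneq p 1; first by rewrite /=; lia.
by rewrite ltn_eqF; lia.
Qed.

(** The block consists of the first n digits of c, where n is the first shift at
which c falls below its reflection. A tie between a suffix of this block and a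
reflected prefix is impossible: it would turn the fall at n into a shift of c
exceeding c. Since c continues below its reflection whereas theta continues
above it, c < theta. The condition on the first digits replaces the lower
bound by the Komornik-Loreti constant. *)
Lemma admissible_cover (N : nat) (c : nat -> nat) : 1 < N ->
  (forall k, c k < N) ->
  (forall n, ~ seqlt c (tail n c)) ->
  (N./2 < c 0) || [&& ~~ odd N, c 0 == N./2 & N./2 <= c 1] ->
  (exists n, seqlt (tail n c) (mirror N c)) ->
  exists t, [/\ admissible_block N t, seqlt (periodic_seq t) c &
                seqlt c (theta N t)].
Proof.
move=> N1 dig upper head ex.
have hN2 := odd_double_half N.
have exb : exists n, `[< seqlt (tail n c) (mirror N c) >].
  by case: ex => n H; exists n; apply/asboolP.
case: (ex_minnP exb) => n /asboolP low minn.
have nlow i : i < n -> ~ seqlt (tail i c) (mirror N c).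
  by move=> lt /asboolP /minn; lia.
have n0 : 0 < n.
  rewrite lt0n; apply/eqP => n0; move: low; rewrite n0 => -[[|j]] [eq].
    by rewrite /tail /mirror addn0; move: head; lia.
  by have := eq 0 isT; rewrite /tail /mirror addn0; move: head; lia.
have gen_low i : 0 < i < n -> lexlt (n - i) (mirror N c) (tail i c).
  move=> /andP[i0 ip].
  have [eq|[//|[j _ H]]] := lex_diffP (n - i) (mirror N c) (tail i c); last first.
    by case: (nlow i ip); exists j.
  have [j [eqj ltj]] := low; case: (upper (n - i)).
  have [e|[[j1 [e1 l1]]|[j1 [e1 l1]]]] :=
      seq_diffP (tail n c) (mirror N (tail (n - i) c)).
  - exists j; split=> [k kj|].
      have := eqj k kj; rewrite e /mirror; have := dig k; have := dig (n - i + k).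
      by rewrite /tail; lia.
    by move: ltj; rewrite e /mirror; lia.
  - case: (nlow i ip); exists (n - i + j1); split=> [k kj|].
      have [kn|kn] := ltnP k (n - i); first by rewrite eq.
      have := e1 (k - (n - i)); rewrite /mirror /tail subnKC //.
      by rewrite (_ : n + _ = i + k); [apply; lia | lia].
    move: l1; rewrite /mirror /tail.
    by rewrite (_ : n + j1 = i + (n - i + j1)); lia.
  - have agree k : k < j -> k < j1 -> c k = tail (n - i) c k.
      move=> kj kj1; have := eqj k kj; rewrite -e1 // /mirror.
      by have := dig k; have := dig (n - i + k); rewrite /tail; lia.
    have [jj|jj|jj] := ltngtP j j1.
    + exists j; split=> [k kj|]; first by apply: agree => //; lia.
      by move: ltj; rewrite -e1 // /mirror; lia.
    + exists j1; split=> [k kj|]; first by apply: agree => //; lia.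
      by move: l1; rewrite eqj // /mirror; lia.
    + exists j; split=> [k kj|]; first by apply: agree => //; lia.
      by move: l1 ltj; rewrite -jj /mirror; lia.
have gen : generator N c n.
  split=> //.
  - have [n1|n1] := eqVneq n 1; first by rewrite n1 /=; move: head; lia.
    have [|j jn [eq lt]] := gen_low n.-1; first by lia.
    by move: lt; rewrite (_ : j = 0) /tail ?addn0; lia.
  - have [n1|n1] := eqVneq n 1; last by move: head; lia.
    have [lt|] := boolP (N./2 < c 0); first by rewrite /=; lia.
    move=> nlt; move: head; rewrite (negbTE nlt) /= => /and3P[ev /eqP c0 c1].
    move: low; rewrite n1 => -[[|j]] [eq].
      by rewrite /tail /mirror addn0; lia.
    by have := eq 0 isT; rewrite /tail /mirror addn0; lia.
  - by move=> i ip [j _ H]; apply: (upper i); exists j.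
pose t := mkseq (decr_last c n) n.
have st : size t = n by rewrite size_mkseq.
have st0 : 0 < size t by rewrite st.
have agree k : k < n -> c k = nth 0 (incr_last t) k.
  move=> kn; rewrite nth_incr_last st nth_mkseq // /decr_last.
  have [->|ne] := eqVneq k n.-1; last by lia.
  by have := generator_last gen; lia.
have adm : admissible_block N t.
  by apply: generator_admissible; rewrite st //; apply: generator_agree gen.
have agreeT k : k < n -> theta N t k = c k.
  by move=> kn; rewrite theta_start ?st // agree.
have dbl k : k < n -> theta N t (n + k) = mirror N (theta N t) k + (k == n.-1).
  by have := @theta_doubling N t st0 0 k; rewrite mul1n st.
exists t; split=> //.
  rewrite -(funext (per_theta N st0)) st; exists n.-1; split=> [k kn|].
    by rewrite per_lt // agreeT //; lia.
  rewrite /per modn_small ?/decr_last ?eqxx; last by lia.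
  by rewrite agreeT; have := generator_last gen; lia.
have [j [eqj ltj]] := low; have [jn|jn] := ltnP j n.
  exists (n + j); split=> [k kn|].
    have [kn'|kn'] := ltnP k n; first by rewrite agreeT.
    have := eqj (k - n); have := dbl (k - n); rewrite /tail subnKC // => -> //; last by lia.
    rewrite /mirror agreeT; last by lia.
    by move=> ->; lia.
  rewrite dbl // /mirror agreeT //.
  by move: ltj; rewrite /tail /mirror; lia.
exists (n + n.-1); split=> [k kn|].
  have [kn'|kn'] := ltnP k n; first by rewrite agreeT.
  have := eqj (k - n); have := dbl (k - n); rewrite /tail subnKC // => -> //; last by lia.
  rewrite /mirror agreeT; last by lia.
  by move=> ->; lia.
rewrite dbl ?eqxx; last by lia.
rewrite /mirror agreeT; last by lia.
have [jn'|jn'] := ltnP n.-1 j; last by lia.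
by have := eqj n.-1 jn'; rewrite /tail /mirror; lia.
Qed.

Local Open Scope ring_scope.

(** * Remainders and quasi-greedy expansions *)

(** x^n times what the first n digits of c leave of 1 in base x. *)
Fixpoint remainder (R : realType) (x : R) (c : nat -> nat) (n : nat) : R :=
  if n is m.+1 then x * remainder x c m - (c m)%:R else 1.

Definition expands (R : realType) (x : R) (c : nat -> nat) (n : nat) : Prop :=
  forall i, (i <= n)%N -> 0 < remainder x c i <= 1.

Section Remainder.
Variable R : realType.
Implicit Types (x y b : R) (c d : nat -> nat).

(** Ties the recursion of the quasi-greedy algorithm to the remainders. *)
Lemma remainder_sum x c n : x != 0 ->
  \sum_(i < n) (c i)%:R / x ^+ i.+1 = 1 - remainder x c n / x ^+ n.
Proof.
move=> x0; elim: n => [|n IH]; first by rewrite big_ord0 expr0 divr1 subrr.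
rewrite big_ord_recr /= IH.
have xn : x ^+ n != 0 by rewrite expf_neq0.
by rewrite exprS; field; rewrite x0 xn.
Qed.

Lemma eq_remainder x c d n : (forall i, (i < n)%N -> c i = d i) ->
  remainder x c n = remainder x d n.
Proof.
elim: n => [//|n IH] cd /=; rewrite cd // IH // => i /ltnW; exact: cd.
Qed.

Lemma remainder_continuous c n : continuous (fun x => remainder x c n).
Proof.
elim: n => [|n IH] x /=; first exact: cvg_cst.
by apply: cvgB; [apply: cvgM; [exact: cvg_id | exact: IH] | exact: cvg_cst].
Qed.

Lemma max_digitP (N : nat) (y : R) : 0 < y <= N%:R ->
  (\max_(d < N | (d%:R < y)%R) d)%N%:R < y
    <= (\max_(d < N | (d%:R < y)%R) d)%N.+1%:R.
Proof.
move=> /andP[y0 yN]; have N0 : (0 < N)%N by rewrite -(ltr_nat R); lra.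
set d := (\max_(_ < _ | _) _)%N.
have [i iy dE] : {i : 'I_N | i \in [pred i : 'I_N | i%:R < y] & d = i}.
  apply: eq_bigmax_cond; apply/card_gt0P.
  by exists (Ordinal N0); rewrite inE.
rewrite inE in iy; rewrite {1}dE iy /= leNgt; apply/negP => lt.
have iN : (d.+1 < N)%N by rewrite -(ltr_nat R); lra.
have := @leq_bigmax_cond _ (fun d : 'I_N => d%:R < y)
  (fun d : 'I_N => d : nat) (Ordinal iN) lt.
by rewrite -/d /= ltnn.
Qed.

Lemma digit_uniq (y : R) (d e : nat) : d%:R < y <= d.+1%:R ->
  e%:R < y <= e.+1%:R -> d = e.
Proof.
move=> /andP[d1 d2] /andP[e1 e2]; apply/eqP; rewrite eqn_leq.
by rewrite -(ltnS d) -(ltnS e) -!(ltr_nat R) (lt_le_trans d1) // (lt_le_trans e1).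
Qed.

Lemma size_quasi_greedy_block (N : nat) b n :
  size (quasi_greedy_block N b n) = n.
Proof. by elim: n => //= n IH; rewrite size_rcons IH. Qed.

Lemma nth_quasi_greedy_block (N : nat) b n i : (i < n)%N ->
  nth 0%N (quasi_greedy_block N b n) i = quasi_greedy N b i.
Proof.
elim: n => // n IH; rewrite ltnS leq_eqVlt => /orP[/eqP-> //|lt].
by rewrite -(IH lt) /= nth_rcons size_quasi_greedy_block lt.
Qed.

Lemma quasi_greedyE (N : nat) b n : 0 < b ->
  quasi_greedy N b n =
  (\max_(d < N | (d%:R < b * remainder b (quasi_greedy N b) n)%R) d)%N.
Proof.
move=> b0; rewrite /quasi_greedy /= nth_rcons size_quasi_greedy_block ltnn eqxx.
apply: eq_bigl => d.
have -> : \sum_(i < n) (nth 0%N (quasi_greedy_block N b n) i)%:R / b ^+ i.+1 =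
    \sum_(i < n) (quasi_greedy N b i)%:R / b ^+ i.+1.
  by apply: eq_bigr => i _; rewrite nth_quasi_greedy_block.
rewrite remainder_sum ?gt_eqF // -subr_gt0.
have bn : 0 < b ^+ n by rewrite exprn_gt0.
have bn1 : 0 < b ^+ n.+1 by rewrite exprn_gt0.
set r := remainder _ _ _.
rewrite (_ : _ - _ = (b * r - d%:R) / b ^+ n.+1).
  by rewrite pmulr_lgt0 ?invr_gt0 // subr_gt0.
by rewrite exprS; field; rewrite !gt_eqF.
Qed.

Lemma expands_quasi_greedy (N : nat) b n : 0 < b <= N%:R ->
  expands b (quasi_greedy N b) n.
Proof.
move=> /andP[b0 bN]; elim => [|i IH] ilt; first by rewrite /= ltr01 lexx.
have /andP[r0 r1] := IH (ltnW ilt).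
rewrite /= quasi_greedyE //; set y := b * _.
have /max_digitP : 0 < y <= N%:R.
  rewrite /y mulr_gt0 //= (le_trans _ bN) //.
  by rewrite ler_piMr // ltW.
by move=> /andP[l1 l2]; rewrite subr_gt0 l1 /= lerBlDr -natr1 addrC in l2 *.
Qed.

(** Digit n is forced by x P_n lying in the half-open interval from c_n to
c_n + 1, so finitely many digits are controlled by finitely many remainders;
the local form is needed to describe nearby bases. *)
Lemma expands_digits (N : nat) b c n : 0 < b <= N%:R -> expands b c n ->
  forall i, (i < n)%N -> quasi_greedy N b i = c i.
Proof.
move=> bN H; elim/ltn_ind => i IH lt.
have agree j : (j < i)%N -> quasi_greedy N b j = c j.
  by move=> ji; apply: IH => //; exact: ltn_trans lt.
have /andP[b0 b1] := bN.
have E := eq_remainder b agree.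
have := @expands_quasi_greedy N b i.+1 bN _ (leqnn _); have := H _ lt.
rewrite /= E => /andP[l1 l2] /andP[l3 l4].
apply: (@digit_uniq (b * remainder b c i)).
  by rewrite -natr1; lra.
by rewrite -natr1; lra.
Qed.

Lemma quasi_greedy_eq (N : nat) b c : 0 < b <= N%:R ->
  (forall n, 0 < remainder b c n <= 1) -> quasi_greedy N b =1 c.
Proof. by move=> bN H i; apply: (expands_digits bN (n := i.+1)). Qed.

Lemma quasi_greedy_bound (N : nat) b n : 0 < b <= N%:R ->
  0 < remainder b (quasi_greedy N b) n <= 1.
Proof. by move=> bN; apply: (@expands_quasi_greedy N b n bN n (leqnn n)). Qed.

Lemma quasi_greedy_digit (N : nat) b n : 0 < b <= N%:R ->
  (quasi_greedy N b n < N)%N.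
Proof.
move=> bN; have /andP[b0 bN'] := bN.
have /andP[l1 _] := quasi_greedy_bound n.+1 bN.
have /andP[_ l2] := quasi_greedy_bound n bN.
rewrite -(ltr_nat R); move: l1 => /=; rewrite subr_gt0 => /lt_le_trans; apply.
by apply: le_trans bN'; rewrite ler_piMr // ltW.
Qed.

End Remainder.

(** * Monotonicity and existence of expansions *)

Section Expansion.
Variable R : realType.
Implicit Types (x y b : R) (c d : nat -> nat).

Lemma expr_unbounded x K : 1 < x -> exists n, K < x ^+ n.
Proof.
move=> x1; pose n := Num.bound `|K / (x - 1)|.
have bern m : 1 + m%:R * (x - 1) <= x ^+ m.
  elim: m => [|m IH]; first by rewrite expr0 mul0r addr0.
  rewrite exprS -natr1; have m0 : 0 <= (m%:R : R) by [].
  have : x * (1 + m%:R * (x - 1)) <= x * x ^+ m by rewrite ler_pM2l //; lra.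
  have : 0 <= m%:R * ((x - 1) * (x - 1)) by rewrite !mulr_ge0 //; lra.
  move=> h h2; apply: le_trans h2; lra.
exists n; apply: lt_le_trans (bern n).
have x10 : 0 < x - 1 by lra.
have : K / (x - 1) < n%:R.
  by apply: le_lt_trans (ler_norm _) _; rewrite /n archi_boundP.
rewrite ltr_pdivrMr //; move: (n%:R : R) => z; lra.
Qed.

Lemma remainderS x c n : remainder x c n.+1 = x * remainder x c n - (c n)%:R.
Proof. by []. Qed.

(** Derivative bound without derivatives: each step multiplies the gap by at
least [y], as long as the remainders at [x] are nonnegative. *)
Lemma remainder_increase x y c n : 0 <= x <= y ->
  (forall i, (i <= n)%N -> 0 <= remainder x c i) ->
  y ^+ n * (y - x) <= remainder y c n.+1 - remainder x c n.+1.
Proof.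
move=> /andP[x0 xy]; elim: n => [|n IH] H; first by rewrite /= expr0; lra.
have {}IH := IH (fun i ilt => H i (leqW ilt)).
rewrite exprS -mulrA [remainder y c n.+2]remainderS [remainder x c n.+2]remainderS.
have H1 := H n.+1 (leqnn _).
move: (remainder y c n.+1) (remainder x c n.+1) H1 IH => Q P H1 IH.
have : y * (y ^+ n * (y - x)) <= y * (Q - P) by rewrite ler_wpM2l //; lra.
have : 0 <= (y - x) * P by rewrite mulr_ge0 //; lra.
by lra.
Qed.

(** A smaller remainder in a smaller base produces lexicographically smaller
digits. Applied to two bases this is monotonicity of the expansion; applied to
one base and a shifted remainder, which starts at most at 1, it bounds the
shifts of the expansion. *)
Lemma digits_monotone x y c d (p q : nat -> R) : 0 < x <= y ->
  (forall n, p n.+1 = x * p n - (c n)%:R) ->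
  (forall n, q n.+1 = y * q n - (d n)%:R) ->
  (forall n, 0 < p n) -> (forall n, q n <= 1) -> p 0%N <= q 0%N ->
  ~ seqlt d c.
Proof.
move=> /andP[x0 xy] pE qE p0 q1 pq0 [j [eqj ltj]].
have pq i : (i <= j)%N -> x * p i <= y * q i.
  elim: i => [_|i IH ilt]; first by rewrite ler_pM // ltW.
  rewrite ler_pM ?(ltW x0) ?(ltW (p0 _)) // pE qE eqj //.
  by have := IH (ltnW ilt); lra.
have := pq j (leqnn _); have := p0 j.+1; have := q1 j.+1.
move: ltj; rewrite pE qE -(ler_nat R) -natr1; lra.
Qed.

Lemma quasi_greedy_upper (N : nat) b n : 0 < b <= N%:R ->
  ~ seqlt (quasi_greedy N b) (tail n (quasi_greedy N b)).
Proof.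
move=> bN; have H := quasi_greedy_bound _ bN; have /andP[b0 _] := bN.
apply: (@digits_monotone b b _ _ (fun i => remainder b (quasi_greedy N b) (n + i))
  (fun i => remainder b (quasi_greedy N b) i)) => //.
- by rewrite b0 lexx.
- by move=> i; rewrite addnS.
- by move=> i; have /andP[] := H (n + i)%N.
- by move=> i; have /andP[] := H i.
- by have /andP[] := H (n + 0)%N.
Qed.

Lemma quasi_greedy_le (N : nat) x y : 0 < x -> x <= y -> y <= N%:R ->
  ~ seqlt (quasi_greedy N y) (quasi_greedy N x).
Proof.
move=> x0 xy yN; have xN : 0 < x <= N%:R by rewrite x0 (le_trans xy).
have yN' : 0 < y <= N%:R by rewrite (lt_le_trans x0).
apply: (@digits_monotone x y _ _ (remainder x (quasi_greedy N x))
  (remainder y (quasi_greedy N y))) => //; first by rewrite x0.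
- by move=> i; have /andP[] := quasi_greedy_bound i xN.
- by move=> i; have /andP[] := quasi_greedy_bound i yN'.
Qed.

(** With equal digits the gap between the remainders grows like y^n, but both
stay in the unit interval. *)
Lemma quasi_greedy_inj_lt (N : nat) x y : 0 < x -> x < y -> 1 < y -> y <= N%:R ->
  ~ (quasi_greedy N x =1 quasi_greedy N y).
Proof.
move=> x0 xy y1 yN e; have xN : 0 < x <= N%:R by rewrite x0 (le_trans _ yN) // ltW.
have yN' : 0 < y <= N%:R by rewrite (lt_trans x0).
have [n yn] := expr_unbounded (1 / (y - x)) y1.
have := @remainder_increase x y (quasi_greedy N x) n.
rewrite {1}(@eq_remainder _ y (quasi_greedy N x) (quasi_greedy N y)) //.
have /andP[q0 q1] := quasi_greedy_bound n.+1 yN'.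
have /andP[p0 p1] := quasi_greedy_bound n.+1 xN.
rewrite (ltW x0) (ltW xy) => /(_ isT) H.
have {}H := H (fun i _ => ltW (proj1 (andP (quasi_greedy_bound i xN)))).
rewrite ltr_pdivrMr in yn; last by rewrite subr_gt0.
lra.
Qed.

Lemma quasi_greedy_seqlt (N : nat) x y : 0 < x <= N%:R -> 0 < y <= N%:R ->
  seqlt (quasi_greedy N x) (quasi_greedy N y) -> x < y.
Proof.
move=> /andP[x0 xN] /andP[y0 yN] H; rewrite ltNge; apply/negP => yx.
exact: quasi_greedy_le yx xN H.
Qed.

Lemma remainder_le0 x c n m : 0 <= x -> (n <= m)%N ->
  remainder x c n <= 0 -> remainder x c m <= 0.
Proof.
move=> x0 /subnK<-; elim: (m - n)%N => [//|k IH] /IH H.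
by rewrite addSn /= subr_le0 (le_trans _ (ler0n _ _)) // mulr_ge0_le0.
Qed.

(** The base is the supremum of the points where some remainder is nonpositive.
At the supremum all remainders are positive, since a nonpositive one would
become negative at the next nonzero digit and stay so slightly to the right.
They are bounded because a remainder above N/(b-1) can only grow, also slightly
to the left. Hence the remainder divided by b^n tends to 0, i.e. the digits sum
to 1 in base b. *)
Lemma base_exists (N : nat) c : (forall k, c k < N)%N ->
  (forall n, exists2 k, (n <= k)%N & (0 < c k)%N) ->
  exists b, 1 < b <= N%:R /\
    forall n, 0 < remainder b c n <= N%:R / (b - 1).
Proof.
move=> dig inf.
pose A := [set x : R | 1 <= x /\ exists n, remainder x c n <= 0].
have A1 : A 1.
  split=> //; have [k _ ck] := inf 0%N; exists k.+1.
  rewrite /= mul1r subr_le0; apply: (@le_trans _ _ 1); last by rewrite ler1n.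
  elim: k {ck} => [//|k IH]; rewrite /= mul1r lerBlDr.
  by apply: le_trans IH _; rewrite lerDl.
have big x n : N%:R <= x -> 1 <= remainder x c n.
  move=> Nx; elim: n => [//|n IH] /=.
  have : (c n)%:R + 1 <= (N%:R : R) by rewrite natr1 ler_nat.
  have : x * 1 <= x * remainder x c n.
    by rewrite ler_wpM2l // (le_trans _ Nx).
  lra.
have ubA : ubound A N%:R.
  move=> x [x1 [n xn]]; rewrite leNgt; apply/negP => /ltW h.
  by have := big x n h; lra.
have supA : has_sup A by split; [exists 1 | exists N%:R].
pose b := sup A.
have b1 : 1 <= b by apply: ub_le_sup => //; exists N%:R.
have bN : b <= N%:R by apply: ge_sup => //; exists 1.
have pos n : 0 < remainder b c n.
  rewrite ltNge; apply/negP => bn.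
  have [k nk ck] := inf n.
  have bk : remainder b c k.+1 < 0.
    have := remainder_le0 (le_trans ler01 b1) nk bn => h /=.
    have : 0 < (c k)%:R :> R by rewrite ltr0n.
    have : b * remainder b c k <= 0 by rewrite mulr_ge0_le0 //; lra.
    lra.
  have [e /= e0 He] :=
    (nbhs_ballP _ _).1 (cvgr_lt _ (@remainder_continuous R c k.+1 b) _ bk).
  have : remainder (b + e / 2) c k.+1 < 0.
    apply: He; rewrite /ball /= opprD addrA subrr sub0r normrN gtr0_norm; lra.
  move=> /ltW h; have : A (b + e / 2) by split; [lra | exists k.+1].
  move=> /(ub_le_sup _); rewrite -/b => /(_ (ex_intro _ _ ubA)); lra.
have {}b1 : 1 < b.
  rewrite lt_neqAle b1 andbT; apply/eqP => b1'.
  case: A1 => _ [n]; rewrite b1'; have := pos n; lra.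
exists b; split; first by rewrite b1.
move=> M; rewrite pos /= leNgt; apply/negP => HM.
rewrite ltr_pdivrMr in HM; last by lra.
have cont : {for b, continuous (fun x => remainder x c M * (x - 1))}.
  apply: cvgM; first exact: remainder_continuous.
  by apply: cvgB; [exact: cvg_id | exact: cvg_cst].
have [e /= e0 He] := (nbhs_ballP _ _).1 (cvgr_gt _ cont _ HM).
have [x [x1 [k xk]] xb] := sup_adherent e0 supA.
rewrite -/b in xb.
have xb' : x <= b by apply: ub_le_sup => //; [exists N%:R | split=> //; exists k].
have gx : N%:R < remainder x c M * (x - 1).
  by apply: He; rewrite /ball /= ger0_norm; lra.
have N0 : 0 <= N%:R :> R by [].
have x0 : 0 <= x by lra.
have xM : 0 < remainder x c M.
  rewrite ltNge; apply/negP => h.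
  have : remainder x c M * (x - 1) <= 0 by rewrite mulr_le0_ge0 //; lra.
  lra.
have grow i : remainder x c M <= remainder x c (M + i).
  elim: i => [|i IH]; first by rewrite addn0.
  rewrite addnS /=.
  have : (c (M + i)%N)%:R <= N%:R :> R by rewrite ler_nat ltnW.
  have : remainder x c M * (x - 1) <= remainder x c (M + i) * (x - 1).
    by rewrite ler_wpM2r // subr_ge0.
  lra.
have [kM|Mk] := leqP k M.
  have := remainder_le0 x0 kM xk; lra.
have := grow (k - M)%N; rewrite subnKC; last exact: ltnW.
lra.
Qed.

(** If a remainder exceeds 1, compare the shifted digits with c: at the first
difference, which is in favour of c, the excess over 1 has been multiplied by
at least [b]. *)
Lemma remainder_escape b c m : 1 < b ->
  (forall n, 0 < remainder b c n) ->
  (forall n, ~ seqlt c (tail n c)) ->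
  1 < remainder b c m ->
  forall K, exists M, K < remainder b c M.
Proof.
move=> b1 pos upper m1 K.
have b0 : 0 < b by lra.
have shiftE i j : (forall k, (k < j)%N -> c (i + k)%N = c k) ->
    remainder b c (i + j)%N - remainder b c j = b ^+ j * (remainder b c i - 1).
  elim: j => [|j IH] H; first by rewrite addn0 /= expr0; lra.
  rewrite addnS /= H // exprS -mulrA -IH; first by ring.
  by move=> k kj; apply: H; apply: ltnW.
have stp i : 1 < remainder b c i ->
    exists2 j, (0 < j)%N & b ^+ j * (remainder b c i - 1) <= remainder b c (i + j)%N - 1.
  move=> i1; have i0 : (0 < i)%N by case: i i1 => [|//]; rewrite /= ltxx.
  have [e|[[j [eq lt]]|/upper//]] := seq_diffP (tail i c) c.
    by exists i => //; rewrite -shiftE; [lra | move=> k _; exact: e].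
  exists j.+1 => //.
  have := shiftE i j eq; rewrite addnS /= => h.
  have := pos j.+1; rewrite /= exprS -mulrA => pj.
  have : 1 + (tail i c j)%:R <= (c j)%:R :> R by rewrite nat1r ler_nat.
  have : b * (b ^+ j * (remainder b c i - 1)) =
         b * (remainder b c (i + j) - remainder b c j) by rewrite h.
  rewrite /tail; lra.
have grow k : exists2 i, 1 < remainder b c i &
    b ^+ k * (remainder b c m - 1) <= remainder b c i - 1.
  elim: k => [|k [i i1 IH]]; first by exists m => //; rewrite expr0 mul1r.
  have [j j0 H] := stp i i1.
  have bj : b <= b ^+ j by rewrite -{1}(expr1 b) ler_weXn2l // ltW.
  have : b * (b ^+ k * (remainder b c m - 1)) <= b ^+ j * (remainder b c i - 1).
    by apply: ler_pM => //; rewrite ?mulr_ge0 ?exprn_ge0 //; lra.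
  rewrite mulrA -exprS => H2; exists (i + j)%N; last by lra.
  have : 0 < b ^+ j * (remainder b c i - 1) by rewrite mulr_gt0 ?exprn_gt0 ?subr_gt0.
  lra.
have [k bk] := expr_unbounded (K / (remainder b c m - 1)) b1.
have [i _ H] := grow k; exists i.
rewrite ltr_pdivrMr in bk; last by rewrite subr_gt0.
lra.
Qed.

Lemma expansion_exists (N : nat) c : (forall k, c k < N)%N ->
  (forall n, ~ seqlt c (tail n c)) ->
  (forall n, exists2 k, (n <= k)%N & (0 < c k)%N) ->
  exists b, 1 < b <= N%:R /\ quasi_greedy N b =1 c.
Proof.
move=> dig upper inf; have [b [bN H]] := base_exists dig inf.
have /andP[b1 _] := bN.
have pos n : 0 < remainder b c n by have /andP[] := H n.
exists b; split=> //; apply: quasi_greedy_eq.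
  by have /andP[_ ->] := bN; rewrite andbT; lra.
move=> m; rewrite pos /= leNgt; apply/negP => m1.
have [M HM] := remainder_escape b1 pos upper m1 (N%:R / (b - 1)).
by have /andP[_] := H M; lra.
Qed.

End Expansion.

(** * Porous sets are null *)

Section Porosity.
Variable R : realType.
Implicit Types (x y b e d : R) (c : nat -> nat).

(** The closure of B still misses the holes, which are open, so that no point of B
is a density point of this closed set. Passing to the closure is what gives
measurability. *)
Lemma porous_negligible (B : set R) :
  (forall x, B x -> exists e, 0 < e <= 1 /\ forall d, 0 < d ->
     exists a, x - d < a < x /\ forall y, a < y < a + e * (x - a) -> ~ B y) ->
  (@lebesgue_measure R).-negligible B.
Proof.
move=> hole; set mu := @lebesgue_measure R; pose C := closure B.
have mC : measurable C by apply: measurable_realfun.closed_measurable; exact: closed_closure.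
have := lebesgue_density mC; rewrite /almost_everywhere /=.
apply: negligibleS => x Bx /=.
have -> : \1_C x = 1 :> R.
  by rewrite indicE mem_set //; exact: subset_closure.
have [e [/andP[e0 e1] he]] := hole x Bx.
move=> cvg1.
have near1 : nbhs (1%:E : \bar R) [set z | ((1 - e / 4)%:E < z)%E].
  apply: open_nbhs_nbhs; split; first exact: open_ereal_gt_ereal.
  by rewrite /= lte_fin; lra.
have := cvg1 _ near1; rewrite /nbhs /= /at_right /within /=.
move=> /nbhs_ballP[d /= d0 Hd].
have [a [/andP[ax1 ax2] ha]] := he _ d0.
pose r := x - a; have r0 : 0 < r by rewrite /r; lra.
have := Hd r; rewrite /ball /= sub0r normrN gtr0_norm // => /(_ _ r0).
rewrite /r => /(_ ltac:(lra)); rewrite -/r -/mu.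
have mball : mu (ball x r) = (r *+ 2)%:E by rewrite /mu lebesgue_measure_ball // ltW.
rewrite -/(ball x r) mball inver gt_eqF ?lte_pdivlMr; try by rewrite mulrn_wgt0.
pose I := `]a, a + e * r[%classic : set R.
have er : 0 < e * r by rewrite mulr_gt0.
have muI : mu I = (e * r)%:E.
  rewrite /mu /I lebesgue_measure_itv /= lte_fin ltrDl er.
  by rewrite -EFinD addrAC subrr add0r.
have CI : C `&` I = set0.
  rewrite -subset0 => y [Cy Iy].
  have : nbhs y I by apply: open_nbhs_nbhs; split => //; exact: interval_open.
  move=> /Cy [z [Bz]]; rewrite /I /= in_itv /= => /ha; exact.
have mI : measurable I by exact: measurable_itv.
have mb : measurable (ball x r) by rewrite ball_itv.
have mCb : measurable (C `&` ball x r) by exact: measurableI.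
have dis : (C `&` ball x r) `&` I = set0 by rewrite setIAC CI set0I.
have sub : (C `&` ball x r) `|` I `<=` ball x r.
  move=> y [[_ //]|]; rewrite /I ball_itv /= !in_itv /= => /andP[y1 y2].
  apply/andP; split; first by move: y1; rewrite /r; lra.
  have : e * r <= 1 * r by rewrite ler_wpM2r // ltW.
  by move: y2; rewrite /r; lra.
have : (mu (C `&` ball x r) + mu I <= mu (ball x r))%E.
  rewrite -(measureU mu mCb mI dis); apply: le_measure => //; rewrite inE //.
  exact: measurableU.
rewrite mball muI -[X in (X * _)%E]/((1 - e / 4)%:E) -EFinM.
case: (mu (C `&` ball x r)) => [z| |] //.
rewrite -EFinD lee_fin lte_fin -mulr_natr; nra.
Qed.

End Porosity.

(** * The bases whose expansion stays above its reflection *)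

Section Null.
Variable R : realType.
Implicit Types (x y a b : R) (c : nat -> nat).

Lemma remainder_ge0_root a c n : 0 < a -> remainder a c n = 0 ->
  forall i, (i <= n)%N -> 0 <= remainder a c i.
Proof.
move=> a0 an i ilt; rewrite leNgt; apply/negP => neg.
suff : remainder a c n < 0 by rewrite an ltxx.
rewrite -(subnKC ilt); elim: (n - i)%N => [|k IH]; first by rewrite addn0.
by rewrite addnS /= subr_lt0 (lt_le_trans _ (ler0n _ _)) // pmulr_rlt0.
Qed.

(** Convexity of the remainder to the right of [a], in the form that the value at
[y] lies below the chord from [a] to [x]. *)
Lemma remainder_chord a x y c n : 0 <= a -> a <= y <= x ->
  (forall i, (i <= n)%N -> 0 <= remainder a c i) ->
  (remainder y c n - remainder a c n) * (x - a) <=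
  (remainder x c n - remainder a c n) * (y - a).
Proof.
move=> a0 /andP[ay yx]; elim: n => [|n IH] H; first by rewrite /= subrr !mul0r.
have {}IH := IH (fun i ilt => H i (leqW ilt)).
have ax : 0 <= remainder x c n - remainder a c n.
  case: n IH H => [|n] _ H; first by rewrite subrr.
  apply: le_trans (@remainder_increase _ a x c n _ _).
  - by rewrite mulr_ge0 ?exprn_ge0 //; lra.
  - by rewrite a0 (le_trans ay).
  - by move=> i ilt; apply: H; lia.
have Hn := H n (leqnSn _); rewrite !remainderS.
move: (remainder x c n) (remainder y c n) (remainder a c n) ax IH Hn.
move=> X Y P ax IH P0.
have h1 : y * ((Y - P) * (x - a)) <= y * ((X - P) * (y - a)).
  by rewrite ler_wpM2l //; lra.
have h2 : 0 <= (x - y) * ((X - P) * (y - a)).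
  by rewrite !mulr_ge0 //; lra.
lra.
Qed.

(** This is the set often denoted V in the theory of unique expansions: the upper
bound on the shifts which belongs to its definition holds for every base, by
[quasi_greedy_upper]. *)
Definition lower_bounded (N : nat) : set R :=
  [set x | 1 < x < N%:R /\
    forall n, ~ seqlt (tail n (quasi_greedy N x)) (mirror N (quasi_greedy N x))].

(** More zeros than there are leading maximal digits cannot be bounded below by
the reflection. *)
Lemma zero_run (N : nat) c d k n :
  (k < n)%N -> (c k < N.-1)%N -> (forall i, (i < n)%N -> d i = c i) ->
  (forall i, (i <= k)%N -> d (n + i)%N = 0%N) -> seqlt (tail n d) (mirror N d).
Proof.
move=> kn ck agree zero.
have [e|[[j _ H]|[j jk [_]]]] := lex_diffP k.+1 (tail n d) (mirror N d).
- have := e k (ltnSn _); rewrite /tail zero // /mirror agree //; lia.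
- by exists j.
- by rewrite /tail zero.
Qed.

(** The sequence with all digits equal to N-1 is the expansion in base N only. *)
Lemma exists_digit_lt_max (N : nat) x : 1 < x < N%:R ->
  exists k, (quasi_greedy N x k < N.-1)%N.
Proof.
move=> /andP[x1 xN]; have x0 : 0 < x by lra.
have N0 : (0 < N)%N by rewrite -(ltr_nat R); lra.
have xN' : 0 < x <= N%:R by rewrite x0 ltW.
apply: contrapT => none.
have top i : quasi_greedy N x i = N.-1.
  apply/eqP; rewrite eqn_leq; apply/andP; split.
    by have := @quasi_greedy_digit R N x i xN'; lia.
  by rewrite leqNgt; apply/negP => lt; apply: none; exists i.
apply: (@quasi_greedy_inj_lt R N x N%:R x0 xN _ (lexx _)); first by lra.
apply: fsym; apply: quasi_greedy_eq; first by rewrite lexx andbT; lra.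
move=> n; suff -> : remainder (N%:R : R) (quasi_greedy N x) n = 1 :> R by rewrite ltr01 lexx.
elim: n => [//|n IH]; rewrite remainderS IH top mulr1 -{1}(prednK N0) -natr1.
by rewrite addrAC subrr add0r.
Qed.

(** The hole lies to the right of the root of the n-th remainder, where this
remainder is small enough to force k+1 zeros after the first n digits. *)
Lemma lower_bounded_hole (N : nat) x : lower_bounded N x ->
  exists e, 0 < e <= 1 /\ forall d, 0 < d ->
    exists a, x - d < a < x /\
      forall y, a < y < a + e * (x - a) -> ~ lower_bounded N y.
Proof.
move=> [x1N _]; have /andP[x1 xN] := x1N.
have x0 : 0 < x by lra.
have xN' : 0 < x <= N%:R by rewrite x0 ltW.
have [k ck] := exists_digit_lt_max x1N.
set c := quasi_greedy N x in ck *.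
have Nk : 1 <= (N%:R : R) ^+ k.+1 by rewrite exprn_ege1 //; lra.
have Nk0 : 0 < (N%:R : R) ^+ k.+1 by lra.
exists ((N%:R ^+ k.+1)^-1); split.
  by rewrite invr_gt0 Nk0 /= invf_le1.
move=> d d0.
have [n xn] := expr_unbounded (1 / d) x1.
(* n makes the interval short, k puts the small digit inside the common prefix *)
pose m := (n + k)%N; have xm : 1 / d < x ^+ m.
  by apply: lt_le_trans xn _; rewrite ler_weXn2l ?leq_addr // ltW.
pose M := m.+1.
have c0 : (0 < c 0)%N.
  have /andP[_] := quasi_greedy_bound 1 xN'; rewrite /= mulr1 -/c => h.
  by rewrite lt0n; apply/eqP => c0; move: h; rewrite c0; lra.
have P1 : remainder (1 : R) c M <= 0.
  apply: (@remainder_le0 R 1 c 1 M) => //.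
  by rewrite /= mulr1 subr_le0 ler1n.
have Px i : 0 < remainder x c i <= 1 by exact: quasi_greedy_bound.
have /andP[PM0 PM1] := Px M.
have [||a ain Pa] := @IVT R (fun z => remainder z c M) 1 x 0 (ltW x1).
- by apply: continuous_subspaceT => z; exact: remainder_continuous.
- by rewrite ge_min P1 /= le_max (ltW PM0) orbT.
move: ain; rewrite in_itv /= => /andP[a1 ax].
have a0 : 0 < a by lra.
have {}ax : a < x.
  by rewrite lt_neqAle ax andbT; apply/eqP => e; move: PM0; rewrite -e Pa ltxx.
have Pa_ge := remainder_ge0_root a0 Pa.
exists a; split.
  rewrite ax andbT ltrBlDr -ltrBlDl.
  have := @remainder_increase _ a x c m; rewrite -/M Pa subr0 (ltW a0) (ltW ax).
  move=> /(_ isT (fun i h => Pa_ge i (leqW h))) h.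
  have : 1 < x ^+ m * d by rewrite -ltr_pdivrMr.
  have xm0 : 0 < x ^+ m by rewrite exprn_gt0.
  move=> h2; have : x ^+ m * (x - a) < x ^+ m * d by lra.
  by rewrite ltr_pM2l.
move=> y /andP[ay yh].
have yx : y < x.
  have : (N%:R ^+ k.+1)^-1 * (x - a) <= 1 * (x - a).
    by rewrite ler_wpM2r ?invf_le1 //; lra.
  by move: yh; lra.
have y0 : 0 < y by lra.
have PyM : 0 < remainder y c M.
  have := @remainder_increase _ a y c m; rewrite -/M Pa subr0 (ltW a0) (ltW ay).
  move=> /(_ isT (fun i h => Pa_ge i (leqW h))); apply: lt_le_trans.
  by rewrite mulr_gt0 ?exprn_gt0 // subr_gt0.
have Py i : (i <= M)%N -> 0 < remainder y c i.
  move=> iM; rewrite ltNge; apply/negP => h.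
  by have := remainder_le0 (ltW y0) iM h; rewrite leNgt PyM.
have Py1 i : (i <= M)%N -> remainder y c i <= 1.
  case: i => [|i] iM; first by rewrite /=.
  have /andP[_ x1'] := Px i.+1; apply: le_trans x1'.
  have := @remainder_increase _ y x c i; rewrite (ltW y0) (ltW yx).
  move=> /(_ isT (fun j h => ltW (Py j (leq_trans h (ltnW iM))))).
  have : 0 <= x ^+ i * (x - y) by rewrite mulr_ge0 ?exprn_ge0 //; lra.
  lra.
have small : N%:R ^+ k.+1 * remainder y c M <= 1.
  have := @remainder_chord a x y c M (ltW a0); rewrite Pa !subr0 (ltW ay) (ltW yx).
  move=> /(_ isT Pa_ge) h.
  have h1 : remainder x c M * (y - a) <= 1 * (y - a) by rewrite ler_wpM2r //; lra.
  have h2 : N%:R ^+ k.+1 * (y - a) < x - a.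
    by rewrite -ltr_pdivlMl //; lra.
  have h3 : N%:R ^+ k.+1 * (remainder y c M * (x - a)) <= N%:R ^+ k.+1 * (y - a).
    by rewrite ler_pM2l //; lra.
  have : (N%:R ^+ k.+1 * remainder y c M) * (x - a) <= 1 * (x - a).
    by rewrite -mulrA; lra.
  by rewrite ler_pM2r // subr_gt0.
(* the digits of c up to M, then zeros *)
pose c' i := if (i < M)%N then c i else 0%N.
have c'M i : (i <= M)%N -> remainder y c' i = remainder y c i.
  by move=> iM; apply: eq_remainder => j ji; rewrite /c' (leq_trans ji).
have c'j j : remainder y c' (M + j) = y ^+ j * remainder y c M.
  elim: j => [|j IH]; first by rewrite addn0 c'M // mul1r.
  by rewrite addnS remainderS IH /c' ltnNge leq_addr /= subr0 exprS mulrA.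
have yN' : 0 < y <= N%:R by rewrite y0 ltW // (lt_trans yx).
have exp : expands y c' (M + k.+1).
  move=> i iM; have [lt|ge] := leqP i M.
    by rewrite c'M // Py // Py1.
  rewrite -(subnKC (ltnW ge)) c'j; apply/andP; split.
    by rewrite mulr_gt0 // exprn_gt0.
  apply: le_trans small; rewrite ler_wpM2r ?(ltW PyM) //.
  apply: (@le_trans _ _ (N%:R ^+ (i - M))).
    by rewrite lerXn2r ?nnegrE ?(ltW y0) //; have /andP[_] := yN'.
  by apply: ler_weXn2l; [lra | rewrite leq_subLR].
have dig := expands_digits yN' exp.
move=> [_ low]; apply: (low M); apply: (zero_run (c := c) (k := k)) => //.
- by rewrite ltnS leq_addl.
- by move=> i iM; rewrite dig ?ltn_addr // /c' iM.
- by move=> i ik; rewrite dig ?ltn_add2l // /c' ltnNge leq_addr.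
Qed.

Lemma lower_bounded_negligible (N : nat) :
  (@lebesgue_measure R).-negligible (lower_bounded N).
Proof. by apply: porous_negligible => x; exact: lower_bounded_hole. Qed.

End Null.

(** * The Komornik-Loreti constant *)

Lemma thue_morse_pow2 n : thue_morse (2 ^ n) = 1%N.
Proof.
have lt : (n < 2 ^ n)%N by apply: ltn_expl.
rewrite /thue_morse (bigD1 (Ordinal lt)) //= divnn expn_gt0 /=.
rewrite big1 // => i; rewrite -val_eqE /= => ne.
have [ni|ilt] := ltnP n i; first by rewrite divn_small // ltn_exp2l.
by rewrite -expnB // oddX /= orbF subn_eq0 leqNgt ltn_neqAle ne ilt.
Qed.

Lemma kl_digit_lt (N i : nat) : (1 < N)%N -> (kl_digit N i < N)%N.
Proof.
have tm j : (thue_morse j <= 1)%N by rewrite /thue_morse; case: odd.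
move=> N1; rewrite /kl_digit; have := odd_double_half N.
by have := tm i; case: ifP => _; lia.
Qed.

(** Guarantees infinitely many nonzero digits, uniformly in the parity of N. *)
Lemma kl_digit_pow2 (N n : nat) : (1 < N)%N -> (0 < kl_digit N (2 ^ n))%N.
Proof.
have tm j : (thue_morse j <= 1)%N by rewrite /thue_morse; case: odd.
move=> N1; rewrite /kl_digit thue_morse_pow2; have := odd_double_half N.
by have := tm (2 ^ n).-1; case: ifP => _; lia.
Qed.

Section KomornikLoreti.
Variables (R : realType) (N : nat).
Hypothesis N1 : (1 < N)%N.

(** The constant is a default-valued selection, so that a solution has to be
exhibited: [base_exists] applied to the defining digits. *)
Lemma komornik_loretiP : is_komornik_loreti N (komornik_loreti R N).
Proof.
apply: xgetPex; pose c i := kl_digit N i.+1.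
have [||b [/andP[b1 bN] H]] := @base_exists R N c.
- by move=> k; apply: kl_digit_lt.
- move=> n; exists (2 ^ n).-1; last by rewrite /c prednK ?expn_gt0 // kl_digit_pow2.
  by have := ltn_expl n (isT : 1 < 2)%N; lia.
have b0 : 0 < b by lra.
exists b; split => //.
have -> : series (fun i => (kl_digit N i.+1)%:R / b ^+ i.+1 : R) =
    (fun n => 1 - remainder b c n / b ^+ n).
  by apply/funext => n; rewrite seriesEord -remainder_sum ?gt_eqF.
rewrite -[X in _ --> X]subr0; apply: cvgB; first exact: cvg_cst.
have gB : (fun n => N%:R / (b - 1) * (b^-1) ^+ n : R) @ \oo --> (0 : R).
  rewrite -(mulr0 (N%:R / (b - 1))); apply: cvgMr; apply: cvg_expr.
  by rewrite gtr0_norm ?invr_gt0 // invf_lt1.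
apply: (squeeze_cvgr _ (cvg_cst 0) gB); near=> n.
have /andP[r0 r1] := H n.
rewrite divr_ge0 ?(ltW r0) ?exprn_ge0 ?(ltW b0) //= exprVn.
by rewrite ler_pM2r // invr_gt0 exprn_gt0.
Unshelve. all: by end_near.
Qed.

Lemma komornik_loreti_sum n : let b := komornik_loreti R N in
  \sum_(i < n) (kl_digit N i.+1)%:R / b ^+ i.+1 <= 1.
Proof.
have [b0 cv] := komornik_loretiP; set b := komornik_loreti R N in b0 cv *.
set u := series _ in cv; have mono : nondecreasing_seq u.
  rewrite /u seriesEnat; apply: nondecreasing_series => k _ _.
  by rewrite divr_ge0 // exprn_ge0 // ltW.
have := nondecreasing_cvgn_le mono (cvgP _ cv) n.
by rewrite (cvg_lim _ cv) // /u seriesEord.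
Qed.

(** The first two terms of the defining series already give k + odd N < beta_c and
(k + odd N) beta_c + k <= beta_c^2 with k = N/2, hence the bounds on the first
two digits of the expansion in every larger base. *)
Lemma above_komornik_loreti x : komornik_loreti R N < x -> x < N%:R ->
  1 < x /\ ((N./2 < quasi_greedy N x 0)%N ||
    [&& ~~ odd N, quasi_greedy N x 0 == N./2 & (N./2 <= quasi_greedy N x 1)%N]).
Proof.
have [b0 _] := komornik_loretiP; set b := komornik_loreti R N in b0 *.
move=> bx xN; have x0 : 0 < x by lra.
have xN' : 0 < x <= N%:R by rewrite x0 ltW.
have := komornik_loreti_sum 2; rewrite /= -/b !big_ord_recl big_ord0 /= addr0.
have -> : kl_digit N 1 = (N./2 + odd N)%N.
  rewrite /kl_digit (thue_morse_pow2 0) /thue_morse big_ord0.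
  by have := odd_double_half N; case: odd => /=; lia.
have t2 : kl_digit N 2 = if odd N then N./2 else N./2.
  rewrite /kl_digit (thue_morse_pow2 1) (thue_morse_pow2 0).
  by have := odd_double_half N; case: odd => /=; lia.
rewrite {}t2 if_same; set c := quasi_greedy N x.
have /andP[_ q1] := quasi_greedy_bound 1 xN'.
have /andP[_ q2] := quasi_greedy_bound 2 xN'.
move: q1 q2; rewrite /= mulr1 -/c => q1 q2.
set k := N./2; have k0 : (0 < k)%N.
  by have := odd_double_half N; case: odd => /=; rewrite -/k; lia.
have k1 : 1 <= k%:R :> R by rewrite ler1n.
rewrite expr1 expr2 natrD => h.
have {}h : (k%:R + (odd N)%:R) * b + k%:R <= b * b.
  have : ((k%:R + (odd N)%:R) / b + k%:R / (b * b)) * (b * b) <= 1 * (b * b).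
    by rewrite ler_wpM2r // mulr_ge0 // ltW.
  rewrite mul1r; apply: le_trans; rewrite le_eqVlt; apply/orP; left; apply/eqP.
  by field; rewrite gt_eqF.
have kb : k%:R + (odd N)%:R < b.
  by rewrite -(ltr_pM2r b0); lra.
have on0 : 0 <= (odd N)%:R :> R by [].
split; first by lra.
have h0 : (k + odd N < (c 0).+1)%N by rewrite -(ltr_nat R) natrD -natr1; lra.
have [//|c0k] /= := ltnP k (c 0%N).
have oN : odd N = false by move: h0; case: odd => //=; lia.
have c0E : c 0%N = k by move: h0; rewrite oN /=; lia.
rewrite oN c0E eqxx /=; rewrite -ltnS -(ltr_nat R) -natr1.
move: q2 h; rewrite c0E oN /= addr0 => q2 h.
have : b * (b - k%:R) < x * (x - k%:R).
  by apply: ltr_pM; move: kb; rewrite oN /=; lra.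
lra.
Qed.

End KomornikLoreti.

(** * Covering and intersections of admissible intervals *)

Theorem theorem2p5 (R : realType) (N : nat) (hN : (2 <= N)%N) :
  {ae (@lebesgue_measure R), forall x : R,
     `]komornik_loreti R N, N%:R[%classic x ->
     (\bigcup_(I in [set J : R * R | admissible_interval N J])
        `[I.1, I.2]%classic) x} /\
  (forall alphaL alphaU betaL betaU : R,
     admissible_interval N (alphaL, alphaU) ->
     admissible_interval N (betaL, betaU) ->
     `[alphaL, alphaU]%classic `&` `[betaL, betaU]%classic = set0 \/
     alphaU = betaU).
Proof.
split.
  apply: negligibleS (lower_bounded_negligible R N) => x /= H.
  apply: contrapT => notV; apply: H; rewrite /= in_itv /= => /andP[bx xN].
  have [x1 head] := above_komornik_loreti hN bx xN.
  have xN' : 0 < x <= N%:R by apply/andP; split; lra.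
  have low : exists n, seqlt (tail n (quasi_greedy N x)) (mirror N (quasi_greedy N x)).
    apply: contrapT => none; apply: notV; split; first by rewrite x1.
    by move=> n h; apply: none; exists n.
  have [t [adm lt1 lt2]] := admissible_cover hN
    (fun k => quasi_greedy_digit k xN') (fun n => @quasi_greedy_upper R N x n xN')
    head low.
  have [t0 _ _ _] := adm.
  have gen := theta_generator adm; have dbl := theta_doubling N t0.
  have [||| bL [bL1 EL]] := @expansion_exists R N (periodic_seq t).
  - by move=> k; rewrite -(per_theta N t0); apply: per_digit gen _.
  - by rewrite -(funext (per_theta N t0)); apply: tail_per_le gen.
  - by move=> n; rewrite -(funext (per_theta N t0)); apply: per_infinite gen.
  have [||| bU [bU1 EU]] := @expansion_exists R N (theta N t).
  - by move=> k; apply: doubling_digit gen dbl.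
  - by move=> n; apply: theta_upper gen dbl.
  - by move=> n; apply: doubling_infinite gen dbl.
  have /andP[l1 l2] := bL1; have /andP[u1 u2] := bU1.
  exists (bL, bU); first by exists t; split=> //; split.
  rewrite /= in_itv /=; apply/andP; split; apply: ltW.
    apply: (@quasi_greedy_seqlt R N) => //; first by rewrite l2 andbT; lra.
    by rewrite (funext EL).
  apply: (@quasi_greedy_seqlt R N) => //; first by rewrite u2 andbT; lra.
  by rewrite (funext EU).
have main (aL aU bL bU : R) : admissible_interval N (aL, aU) ->
    admissible_interval N (bL, bU) -> aL <= bL -> bL <= aU -> aU = bU.
  move=> [s [As [/= /andP[aL1 aLN] /andP[aU1 aUN] EaL EaU]]].
  move=> [t [At [/= /andP[bL1 bLN] /andP[bU1 bUN] EbL EbU]]] ab ba.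
  have e : theta N t =1 theta N s.
    apply: theta_eq_between => //.
      rewrite -(funext EaL) -(funext EbL); apply: quasi_greedy_le => //; lra.
    rewrite -(funext EaU) -(funext EbL); apply: quasi_greedy_le => //; lra.
  have eq : quasi_greedy N aU =1 quasi_greedy N bU.
    by move=> i; rewrite EaU EbU e.
  have [lt|lt|//] := ltgtP aU bU.
    by case: (@quasi_greedy_inj_lt R N aU bU) => //; lra.
  exfalso; apply: (@quasi_greedy_inj_lt R N bU aU _ lt) => //; first by lra.
move=> aL aU bL bU A B.
have [->|/set0P[x [/=]]] := eqVneq (`[aL, aU]%classic `&` `[bL, bU]%classic) set0.
  by left.
rewrite !in_itv /= => /andP[x1 x2] /andP[x3 x4]; right.
have [ab|/ltW ba] := leP aL bL; first by apply: main A B _ _ => //; lra.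
by apply/esym; apply: main B A _ _ => //; lra.
Qed.
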